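(* For every pair of integers $\ell>k\ge 3$, there exist $\beta>0$ and $s_0$ such that, for all integers $n,s$ with $\max\{s_0,\,n/k-\beta n\}<s\le (n-k)/k$, $$\mathrm{ex}_k\bigl(n,\{H_{\ell+1}^k,M_{s+1}^k\}\bigr)=\mathrm{ex}_k\bigl(ks+k-1,\,H_{\ell+1}^k\bigr).$$
   Context: A $k$-graph ($k$-uniform hypergraph) is a pair $(V,E)$ with $V$ finite and $E$ a set of $k$-element subsets of $V$. For a family $\mathcal F$ of $k$-graphs, a $k$-graph is $\mathcal F$-free if it contains no member of $\mathcal F$ as a subgraph; $\mathrm{ex}_k(n,\mathcal F)$ is the maximum number of edges in an $n$-vertex $\mathcal F$-free $k$-graph, and $\mathrm{ex}_k(n,F)=\mathrm{ex}_k(n,\{F\})$. $M_{s+1}^k$ is the $k$-graph consisting of $s+1$ pairwise disjoint edges. $H_{\ell+1}^k$ is the $k$-graph obtained from the complete graph $K_{\ell+1}$ by enlarging each edge with a set of $k-2$ new vertices, where all these sets of new vertices are pairwise disjoint (and disjoint from the vertex set of $K_{\ell+1}$). *)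

(* Defs.v *)
From mathcomp Require Import all_boot all_order all_algebra.
From mathcomp Require Import reals.

Set Implicit Arguments.
Unset Strict Implicit.
Unset Printing Implicit Defensive.

Record hypergraph := Hypergraph {
  vertices : finType;
  edges : {set {set vertices}}
}.

Definition k_uniform (k : nat) (G : hypergraph) : bool :=
  [forall e in edges G, #|e| == k].

(* G has a (not necessarily induced) subgraph isomorphic to F. *)
Definition contains (G F : hypergraph) : bool :=
  [exists f : {ffun vertices F -> vertices G},
     injectiveb f && [forall e in edges F, (f @: e) \in edges G]].

Definition is_free (Fs : seq hypergraph) (G : hypergraph) : bool :=
  all (fun F => ~~ contains G F) Fs.

(* ex_k(n, Fs) for a finite family Fs.  Every n-vertex k-graph is isomorphic
   to one on 'I_n, so it suffices to range over the latter (see leq_exk).  The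
   value is 0 if no n-vertex k-graph is Fs-free, which cannot occur when every
   member of Fs has an edge. *)
Definition exk (k n : nat) (Fs : seq hypergraph) : nat :=
  \max_(E : {set {set 'I_n}} |
        k_uniform k (Hypergraph E) && is_free Fs (Hypergraph E)) #|E|.

(* M_m^k: the i-th edge is {i} x 'I_k. *)
Definition matching (k m : nat) : hypergraph :=
  @Hypergraph ('I_m * 'I_k)%type
    [set [set (i, j) | j : 'I_k] | i : 'I_m].

Definition clique_edge (p : nat) : finType := {e : {set 'I_p} | #|e| == 2}.

(* H_p^k, for k >= 2: the vertices inl i are those of K_p, and the edge e of
   K_p is enlarged with the k - 2 new vertices inr (e, j). *)
Definition expanded_clique (k p : nat) : hypergraph :=
  @Hypergraph ('I_p + clique_edge p * 'I_(k - 2))%type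
    [set (inl @: val e) :|: [set inr (e, j) | j : 'I_(k - 2)] | e : clique_edge p].

Lemma matching_uniform k m : k_uniform k (matching k m).
Proof.
apply/forall_inP => e /imsetP[i _ ->].
by rewrite card_imset ?card_ord // => j1 j2 [].
Qed.

Lemma expanded_clique_uniform k p : 2 <= k -> k_uniform k (expanded_clique k p).
Proof.
move=> k2; apply/forall_inP => _ /imsetP[e _ ->].
rewrite cardsU (card_imset (mem (val e))); last by move=> x y [].
rewrite card_imset ?card_ord; last by move=> x y [].
rewrite (eqP (valP e)) (_ : _ :&: _ = set0) ?cards0 ?subn0 ?subnKC //.
apply/setP => x; rewrite !inE; apply/negP => /andP[/imsetP[y _ ->]].
by case/imsetP.
Qed.

Lemma contains_trans G1 G2 G3 :
  contains G1 G2 -> contains G2 G3 -> contains G1 G3.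
Proof.
case/existsP => f /andP[/injectiveP fi /forall_inP fE].
case/existsP => g /andP[/injectiveP gi /forall_inP gE].
apply/existsP; exists [ffun x => f (g x)]; apply/andP; split.
  by apply/injectiveP => x y; rewrite !ffunE => /fi/gi.
apply/forall_inP => e /gE/fE; rewrite -imset_comp.
by have -> : [ffun x => f (g x)] @: e = (f \o g) @: e
  by apply: eq_imset => x; rewrite ffunE.
Qed.

Lemma leq_exk k Fs G :
  k_uniform k G -> is_free Fs G -> #|edges G| <= exk k #|vertices G| Fs.
Proof.
move=> /forall_inP Gu Gf.
pose r := @enum_rank (vertices G).
have ri : injective r by apply: enum_rank_inj.
pose E := [set r @: (e : {set _}) | e in edges G].
have cE : #|E| = #|edges G| by rewrite card_imset //; apply: imset_inj.
rewrite -cE; apply: (@leq_bigmax_cond _ _ (fun E => #|pred_of_set E|)).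
apply/andP; split.
  by apply/forall_inP => _ /imsetP[e eG ->]; rewrite card_imset //; apply: Gu.
apply: sub_all Gf => F; apply: contra; apply: contains_trans.
apply/existsP; exists [ffun x => enum_val x]; apply/andP; split.
  by apply/injectiveP => x y; rewrite !ffunE => /enum_val_inj.
apply/forall_inP => _ /imsetP[e eG ->]; rewrite -imset_comp.
suff /eq_imset -> : [ffun x => enum_val x] \o r =1 id by rewrite imset_id.
by move=> x; rewrite /= ffunE enum_rankK.
Qed.

(* Main.v *)
(* Call a pair of vertices heavy if its codegree exceeds a constant times
   n^(k-3).  In an H-free k-graph (H the expanded K_{l+1}) heavy pairs form a
   K_{l+1}-free graph, and all but O(n^(k-1)) edges are k-cliques of it.  By the
   Moon-Moser inequalities a near-maximal number of k-cliques forces a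
   near-maximal number of edges, so Furedi's argument gives a colouring with l
   classes of size about n/l such that almost all crossing k-sets are edges.
   Recolouring the exceptional vertices then shows that for large m some
   complete l-partite k-graph is extremal, so ex(m) grows by at least
   c m^(k-1) at each step.

   Let G have n vertices, be H-free and without s+1 disjoint edges, let
   N = ks+k-1, and suppose e(G) > ex(N); then G has such a colouring.  Let L be
   the set of vertices of small degree.  A set Z containing L with |Z| small can
   be avoided by floor((n-|Z|)/k) disjoint edges: exceptional vertices are
   covered greedily, and the rest has a near-perfect matching because l > k and
   the classes are nearly equal.  Hence |L| > n-N-1; put |L| = n-N+x.  If x+1
   disjoint edges meet L, they extend to s+1 disjoint edges.  Otherwise few
   edges meet L, at most x c (N-x)^(k-1), while G-L has N-x vertices, so
   e(G) <= ex(N-x) + x c (N-x)^(k-1) <= ex(N), a contradiction. *)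
Require Import Defs.
From mathcomp Require Import all_boot all_order all_algebra.
From mathcomp Require Import reals.
From mathcomp Require Import perm.
From mathcomp Require Import zify ring lra.

Set Implicit Arguments.
Unset Strict Implicit.
Unset Printing Implicit Defensive.

Import Order.TTheory GRing.Theory Num.Theory.

(** * Counting edges through given vertices *)

Section Counting.
Variable V : finType.
Implicit Types (A B S : {set V}) (E : {set {set V}}).

(** The threshold for heavy pairs comes from greedy embedding: each vertex to be avoided spoils at
    most n^(k-3) edges through a given pair, so a codegree above a bound for |V(H)| times n^(k-3)
    always leaves a usable edge. It is also low enough for all light pairs together to cover only
    O(n^(k-1)) edges.

    The matching outside the exceptional vertices has to be optimal up to rounding, although only
    the number of missing crossing sets at each vertex is controlled. Switching achieves this: the
    vertices are placed in a table whose rows have prescribed colour patterns, rows of equal pattern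
    can exchange entries columnwise, and a large reserve of rows of every pattern makes each bad row
    repairable. The strict inequality l > k leaves the slack that lets the vertices outside the
    reserve be arranged in rows too.

    The constants are chosen backwards: the growth rate [c0] of the extremal function, then the
    degree threshold [g] defining L, the proportion [b] of bad vertices, the stability error [e],
    and last [beta]. *)

Lemma bin_leq_expn n m : 'C(n, m) <= n ^ m.
Proof.
apply: (@leq_trans (n ^_ m)); first by rewrite -bin_ffact leq_pmulr ?fact_gt0.
elim: m => // m IH; rewrite ffactnSr expnSr leq_mul //.
by rewrite leq_subr.
Qed.

Lemma card_ksets_sup A k :
  #|[set e : {set V} | (#|e| == k) && (A \subset e)]| <= #|V| ^ (k - #|A|).
Proof.
apply: leq_trans (bin_leq_expn _ _); rewrite -card_draws.
rewrite -(@card_in_imset _ _ (fun e => e :\: A)); last first.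
  move=> e f; rewrite !inE => /andP[_ Ae] /andP[_ Af] ef.
  by rewrite -[e](setID _ A) -[f](setID _ A) ef (setIidPr Ae) (setIidPr Af).
apply/subset_leq_card/subsetP => _ /imsetP[e /[!inE] /andP[/eqP <- Ae] ->].
by rewrite cardsD (setIidPr Ae).
Qed.

Definition uniform k E := [forall e in E, #|e| == k].

Lemma uniformP k E : reflect (forall e, e \in E -> #|e| = k) (uniform k E).
Proof.
by apply: (iffP forall_inP) => h e /h /eqP //; rewrite eqP.
Qed.

Definition deg E v := #|[set e in E | v \in e]|.
Definition cod E u v := #|[set e in E | (u \in e) && (v \in e)]|.

Lemma codC E u v : cod E u v = cod E v u.
Proof. by apply: eq_card => e; rewrite !inE [(u \in e) && _]andbC. Qed.

Lemma sub_card_sup E k A (P : pred {set V}) : uniform k E ->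
  (forall e, P e -> A \subset e) ->
  #|[set e in E | P e]| <= #|V| ^ (k - #|A|).
Proof.
move=> /uniformP Ek PA; apply: leq_trans (card_ksets_sup A k).
apply/subset_leq_card/subsetP => e /[!inE] /andP[/Ek -> /PA ->].
by rewrite eqxx.
Qed.

Lemma cod_le E k u v : uniform k E -> u != v -> cod E u v <= #|V| ^ (k - 2).
Proof.
move=> Ek uv; have <- : #|[set u; v]| = 2 by rewrite cards2 uv.
apply: sub_card_sup => // e /andP[ue ve].
by rewrite subUset !sub1set ue.
Qed.

Lemma cod3_le E k u v w : uniform k E -> u != v -> w \notin [set u; v] ->
  #|[set e in E | [&& u \in e, v \in e & w \in e]]| <= #|V| ^ (k - 3).
Proof.
move=> Ek uv wuv.
have <- : #|w |: [set u; v]| = 3 by rewrite cardsU1 cards2 uv wuv.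
apply: sub_card_sup => // e /and3P[ue ve we].
by rewrite !subUset !sub1set ue ve we.
Qed.

(** The union bound, in the form in which nearly all edge counts below are made. *)
Lemma card_exists_le (I T : finType) (A : {set I}) (F : I -> {set T}) (S : {set T}) b :
  (forall x, x \in S -> exists2 i, i \in A & x \in F i) ->
  (forall i, i \in A -> #|F i| <= b) -> #|S| <= #|A| * b.
Proof.
move=> SA Fb; apply: (@leq_trans #|\bigcup_(i in A) F i|).
  apply/subset_leq_card/subsetP => x /SA[i iA xi].
  by apply/bigcupP; exists i.
rewrite -sum_nat_const; elim/big_rec2: _ => [|i m s iA IH].
  by rewrite cards0.
by apply: leq_trans (leq_card_setU _ _) _; rewrite leq_add ?Fb.
Qed.

(** An unsuitable edge through u and v contains a third vertex from Z, and each such vertex accounts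
    for at most n^(k-3) edges. *)
Lemma exists_edge_avoiding E k u v (Z : {set V}) : uniform k E ->
  u != v -> #|Z| * #|V| ^ (k - 3) < cod E u v ->
  exists e, [/\ e \in E, u \in e, v \in e & e :&: Z \subset [set u; v]].
Proof.
move=> Ek uv h.
suff /exists_inP[e eE /and3P[ue ve eZ]] : [exists e in E,
    [&& u \in e, v \in e & e :&: Z \subset [set u; v]]] by exists e.
apply: contraLR h => /exists_inPn h.
rewrite -leqNgt; apply: leq_trans (_ : #|Z :\: [set u; v]| * #|V| ^ (k - 3) <= _).
  apply: (@card_exists_le _ _ _
    (fun w => [set e in E | [&& u \in e, v \in e & w \in e]])).
    move=> e /[!inE] /and3P[eE ue ve].
    have /subsetPn[w /setIP[we wZ] wuv] : ~~ (e :&: Z \subset [set u; v]).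
      by have := h _ eE; rewrite ue ve.
    by exists w; rewrite ?inE ?eE ?ue ?ve ?we // wZ andbT -in_set2.
  by move=> w /setDP[_ wuv]; apply: cod3_le.
by rewrite leq_mul2r subset_leq_card ?orbT // subsetDl.
Qed.

End Counting.

(** * Embedding expanded cliques *)

Section Embedding.
Variables (V : finType) (k p : nat) (E : {set {set V}}).
Hypothesis Ek : uniform k E.

(* A crude bound on the number of vertices of the expanded clique. *)
Definition nvertices := p + #|clique_edge p| * k.

Definition heavy u v := (u != v) && (nvertices * #|V| ^ (k - 3) < cod E u v).

Lemma heavy_sym : symmetric heavy.
Proof. by move=> u v; rewrite /heavy eq_sym codC. Qed.

Lemma heavy_irr : irreflexive heavy.
Proof. by move=> u; rewrite /heavy eqxx. Qed.

Variable w : 'I_p -> V.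
Hypothesis wi : injective w.
Let core := [set w i | i : 'I_p].

(* A partial embedding of the expanded clique: h e is the image of the edge e,
   for e in s. *)
Definition expansion (s : {set clique_edge p}) (h : clique_edge p -> {set V}) :=
  (forall e, e \in s -> h e \in E /\ h e :&: core = w @: val e) /\
  {in s &, forall e f, e != f -> h e :&: h f \subset core}.

(** The core and the edges chosen so far have at most [nvertices] vertices, too few to block all
    edges through a heavy pair. *)
Lemma expansion_extend s h e i j : expansion s h -> e \notin s ->
  val e = [set i; j] -> heavy (w i) (w j) -> exists h', expansion (e |: s) h'.
Proof.
move=> [hE hI] es eij /andP[wij].
pose Z := core :|: \bigcup_(f in s) h f.
have Zn : #|Z| <= nvertices.
  apply: leq_trans (leq_card_setU _ _) _; rewrite leq_add //.
    by rewrite card_imset // card_ord.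
  apply: (@leq_trans (#|s| * k)); last by rewrite leq_mul2r max_card orbT.
  apply: (@card_exists_le _ _ _ h) => [x /bigcupP[f fs xf]|f /hE[fE _]].
    by exists f.
  by rewrite (uniformP _ _ Ek).
move=> /(leq_ltn_trans (leq_mul Zn (leqnn _))) /(exists_edge_avoiding Ek wij).
case=> g [gE ig jg gZ].
have wcore x : w x \in core by apply: imset_f.
exists (fun f => if f == e then g else h f); split.
  move=> f /setU1P[->|fs].
    rewrite eqxx; split=> //; rewrite eij imsetU !imset_set1.
    apply/eqP; rewrite eqEsubset; apply/andP; split.
      by apply: subset_trans gZ; apply/setIS/subsetUl.
    by rewrite subUset !sub1set !inE ig jg !wcore.
  by rewrite ifN; [apply: hE | apply: contraNneq es => <-].
have ghf f : f \in s -> g :&: h f \subset core.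
  move=> fs; apply: (@subset_trans _ _ [set w i; w j]).
    apply: subset_trans gZ; apply/setIS/(subset_trans _ (subsetUr _ _)).
    exact: (bigcup_sup f).
  by rewrite subUset !sub1set !wcore.
move=> f1 f2 /setU1P[->|f1s] /setU1P[->|f2s]; rewrite ?eqxx // => f12.
- by rewrite ifN ?ghf // eq_sym.
- by rewrite ifN // setIC ghf.
- have ne f : f \in s -> f != e by move=> fs; apply: contraNneq es => <-.
  by rewrite (negPf (ne _ f1s)) (negPf (ne _ f2s)); apply: hI.
Qed.

(** Heaviness is required only for pairs outside [s], so a pair of unknown codegree can be served by
    an edge prescribed in advance. *)
Lemma expansion_complete s h : expansion s h ->
  (forall e i j, e \notin s -> val e = [set i; j] -> i != j -> heavy (w i) (w j)) ->
  exists h', expansion setT h'.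
Proof.
have [m] := ubnP #|~: s|; elim: m s h => // m IH s h sm sh hs.
have [sT|/subsetPn[e _ es]] := boolP (setT \subset s).
  by exists h; move: sh; rewrite (_ : s = setT) //; apply/eqP; rewrite eqEsubset subsetT.
have /cards2P[i [j [ij eij]]] : #|val e| == 2 := valP e.
have [h' sh'] := expansion_extend sh es eij (hs _ _ _ es eij ij).
apply: (IH _ _ _ sh').
  rewrite -ltnS; apply: leq_trans sm; rewrite ltnS; apply: proper_card.
  rewrite properE setCS subsetUr; apply/subsetPn; exists e; rewrite !inE ?eqxx //.
by move=> f a b /[!inE] /norP[_ fs]; apply: hs.
Qed.

(** Each [h e] meets the core in exactly two vertices, so k - 2 others remain for the new vertices
    of e; these remainders are disjoint because distinct edges meet only in the core. *)
Lemma expansion_contains h : expansion setT h ->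
  contains (Hypergraph E) (expanded_clique k p).
Proof.
case=> hE hI; have {}hE e := hE e (in_setT e).
have {}hI e f := hI e f (in_setT e) (in_setT f).
have hc e : k - 2 = #|h e :\: core|.
  case: (hE e) => eE ec; rewrite cardsD ec (uniformP _ _ Ek) //.
  by rewrite card_imset // (eqP (valP e)).
pose q e j : V := enum_val (cast_ord (hc e) j).
have qh e j : q e j \in h e :\: core by apply: enum_valP.
pose f (x : vertices (expanded_clique k p)) : V :=
  match x with inl i => w i | inr (e, j) => q e j end.
have wcore x : w x \in core by apply: imset_f.
apply/existsP; exists (finfun f); apply/andP; split.
  apply/injectiveP => x y; rewrite !ffunE.
  case: x y => [i|[e j]] [i'|[e' j']] /=.
  - by move=> /wi ->.
  - by move=> ij; have := qh e' j'; rewrite -ij !inE wcore.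
  - by move=> ij; have := qh e j; rewrite ij !inE wcore.
  - move=> qq; have [ee|nee] := eqVneq e e'; last first.
      have /subsetP/(_ (q e j)) := hI _ _ nee; rewrite inE {2}qq.
      have /setDP[-> /negP nc] := qh e j; have /setDP[-> _] := qh e' j'.
      by move=> /(_ isT).
    by move: j' qq; rewrite -ee => j' /enum_val_inj/cast_ord_inj ->.
apply/forall_inP => _ /imsetP[e _ ->] /=; have [eE ec] := hE e.
rewrite (_ : _ @: _ = h e) // imsetU -!imset_comp -[RHS](setID _ core); congr (_ :|: _).
  by rewrite ec; apply: eq_imset => x; rewrite /= ffunE.
apply/setP => x; apply/imsetP/idP => [[j _ ->]|xh].
  rewrite /= ffunE; exact: qh.
exists (cast_ord (esym (hc e)) (enum_rank_in xh x)) => //.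
by rewrite /= ffunE /= /q cast_ordKV enum_rankK_in.
Qed.

End Embedding.

(* The pair (z, w p) of core vertices may be covered by a single edge e,
   which the embedding then has to use. *)
Lemma heavy_core_contains (V : finType) (k l : nat) (E : {set {set V}})
    (z : V) (w : 'I_l -> V) : uniform k E ->
    (forall i, z != w i) -> injective w ->
    (forall i j, i != j -> heavy k l.+1 E (w i) (w j)) ->
    (forall i, heavy k l.+1 E z (w i)) \/
    (exists p e, [/\ e \in E, z \in e, w p \in e,
       (forall i, i != p -> w i \notin e) &
       (forall i, i != p -> heavy k l.+1 E z (w i))]) ->
  contains (Hypergraph E) (expanded_clique k l.+1).
Proof.
move=> Ek zw wi ww hz.
pose v (i : 'I_l.+1) := oapp w z (unlift ord0 i).
have v0 : v ord0 = z by rewrite /v unlift_none.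
have vl i : v (lift ord0 i) = w i by rewrite /v liftK.
have vi : injective v.
  move=> i j; case: (unliftP ord0 i) => [i'|] ->; case: (unliftP ord0 j) => [j'|] ->;
    rewrite ?v0 ?vl //.
  - by move=> /wi ->.
  - by move=> h; have := zw i'; rewrite h eqxx.
  - by move=> h; have := zw j'; rewrite h eqxx.
case: hz => [hz|[p [e [eE ze wpe we hz]]]].
  have [||h hh] := @expansion_complete V k l.+1 E Ek v vi set0 (fun=> set0) _ _;
    last exact: (expansion_contains Ek vi hh).
    by split=> [e|e f]; rewrite !inE.
  move=> e i j _ _.
  case: (unliftP ord0 i) => [i'|] ->; case: (unliftP ord0 j) => [j'|] ->;
    rewrite ?v0 ?vl ?(inj_eq lift_inj) //.
  - exact: ww.
  - by rewrite heavy_sym.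
have c2 : #|[set ord0; lift ord0 p]| == 2 by rewrite cards2.
pose e0 : clique_edge l.+1 := exist _ [set ord0; lift ord0 p] c2.
have [||h hh] := @expansion_complete V k l.+1 E Ek v vi [set e0] (fun=> e) _ _;
    last exact: (expansion_contains Ek vi hh).
  split=> [f /set1P ->|f g]; last by rewrite !inE => /eqP-> /eqP->; rewrite eqxx.
  split=> //; rewrite /= imsetU !imset_set1 v0 vl.
  apply/setP => x; rewrite !inE; apply/andP/orP.
    case=> xe /imsetP[i _ xi]; move: xe; rewrite {}xi.
    case: (unliftP ord0 i) => [i'|] ->; rewrite ?v0 ?vl; last by left.
    move=> wie; right; have [->//|/we] := eqVneq i' p.
    by rewrite wie.
  by case=> /eqP->; split=> //; rewrite -?v0 -?vl imset_f.
move=> f i j /[!inE] fe0 fij.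
case: (unliftP ord0 i) fij => [i'|] ->; case: (unliftP ord0 j) => [j'|] -> fij;
    rewrite ?v0 ?vl ?(inj_eq lift_inj) //.
- exact: ww.
- rewrite heavy_sym => _; apply: hz; apply: contraNneq fe0 => ip.
  by rewrite -val_eqE /= fij ip setUC.
- move=> _; apply: hz; apply: contraNneq fe0 => ip.
  by rewrite -val_eqE /= fij ip.
Qed.

(** * Clique counts (Moon-Moser) *)

Section Complexes.
Variable V : finType.
Implicit Types (S K : {set V}) (P : pred {set V}).

Definition downclosed P := forall S K, S \subset K -> P K -> P S.

Definition faces P j := [set S : {set V} | (#|S| == j) && P S].
Definition extensions P S := [set x | (x \notin S) && P (x |: S)].

(** Double counting of pairs (S, x) with S = K minus x. The weight [H] allows both plain counting
    and the sum of squared degrees in [moon_moser]. *)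
Lemma sum_extensions P j (H : {set V} -> V -> nat) : downclosed P ->
  \sum_(S in faces P j) \sum_(x in extensions P S) H S x =
  \sum_(K in faces P j.+1) \sum_(x in K) H (K :\ x) x.
Proof.
move=> Pd; rewrite !pair_big_dep /=.
rewrite (reindex_onto (fun q : {set V} * V => (q.1 :\ q.2, q.2))
                      (fun q => (q.2 |: q.1, q.2))) /=; last first.
  by move=> [S x] /andP[_ /[!inE] /= /andP[xS _]]; rewrite setU1K.
apply: eq_bigl => -[K x] /=; rewrite xpair_eqE eqxx andbT !inE eqxx /=.
have [xK|xK] := boolP (x \in K); last first.
  by rewrite andbF; apply/negP => /andP[_ /eqP Kx]; move: xK; rewrite -Kx !inE eqxx.
rewrite setD1K // eqxx !andbT (cardsD1 x K) xK add1n eqSS.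
have [PK|] := boolP (P K); last by rewrite !andbF.
by rewrite (Pd _ _ (subsetDl _ _) PK) !andbT.
Qed.

Lemma sum_card_extensions P j : downclosed P ->
  \sum_(S in faces P j) #|extensions P S| = j.+1 * #|faces P j.+1|.
Proof.
move=> Pd; under eq_bigr do rewrite -sum1_card.
rewrite (sum_extensions _ (fun _ _ => 1)) // mulnC -sum_nat_const.
by apply: eq_bigr => K /[!inE] /andP[/eqP Kj _]; rewrite sum1_card Kj.
Qed.

Lemma faces0 P : P set0 -> #|faces P 0| = 1.
Proof.
move=> P0; rewrite (_ : faces P 0 = [set set0]) ?cards1 //.
by apply/setP => S; rewrite !inE cards_eq0; case: eqP => // ->.
Qed.

(** Adding vertices one at a time produces every m-face in m! orders. An abstract downclosed
    predicate is used because the bound is later applied to extensions of a fixed crossing set. *)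
Lemma faces_lower_bound P (a : nat -> nat) m : downclosed P -> P set0 ->
  (forall S, #|S| < m -> P S -> a #|S| <= #|extensions P S|) ->
  \prod_(j < m) a j <= m`! * #|faces P m|.
Proof.
move=> Pd P0; elim: m => [|m IH] aP; first by rewrite big_ord0 faces0.
rewrite big_ord_recr /= factS [m.+1 * _]mulnC -mulnA -sum_card_extensions //.
apply: leq_trans (_ : m`! * #|faces P m| * a m <= _).
  by rewrite leq_mul2r IH ?orbT // => S Sm; apply: aP; apply: ltnW.
rewrite -mulnA leq_mul2l -sum_nat_const leq_sum ?orbT // => S.
by rewrite !inE => /andP[/eqP Sm PS]; rewrite -Sm aP // Sm.
Qed.

Variable g : rel V.
Hypothesis gs : symmetric g.

Definition clique : pred {set V} :=
  fun S => [forall x in S, forall y in S, (x != y) ==> g x y].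

Lemma cliqueP S : reflect {in S &, forall x y, x != y -> g x y} (clique S).
Proof.
apply: (iffP forall_inP) => [h x y xS yS xy|h x xS].
  by have /forall_inP/(_ y yS)/implyP/(_ xy) := h x xS.
by apply/forall_inP => y yS; apply/implyP; apply: h.
Qed.

Lemma downclosed_clique : downclosed clique.
Proof.
move=> S K /subsetP SK /cliqueP h; apply/cliqueP => x y /SK xK /SK yK.
exact: h.
Qed.

Lemma clique0 : clique set0.
Proof. by apply/cliqueP => x y; rewrite inE. Qed.

Notation d := (fun S => #|extensions clique S|).

(** A vertex outside K that extends two facets of K is adjacent to all of K, since two facets cover
    K. So a vertex is counted j + 1 times if it extends K, and at most once otherwise. *)
Lemma sum_extensions_facets j K : #|K| = j.+1 -> clique K ->
  \sum_(x in K) d (K :\ x) <= #|V| + j * d K.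
Proof.
move=> Kj Kc; under eq_bigr do rewrite -sum1_card.
rewrite (exchange_big_dep xpredT) //= -sum1_card.
rewrite -[d K]sum1_card big_distrr /= [X in _ + X]big_mkcond -big_split /=.
apply: leq_sum => v _.
under eq_bigl => x do rewrite !inE.
rewrite muln1 [in X in _ + X]inE; case: (boolP (v \in K)) => vK /=.
  rewrite addn0 sum1_card; apply: (@leq_trans #|[set v]|); last by rewrite cards1.
  apply/subset_leq_card/subsetP => x; rewrite !inE unfold_in /=.
  by move=> /andP[xK]; rewrite !negb_and !negbK orbF eq_sym; case/andP.
case: (boolP (clique (v |: K))) => vKc.
  by rewrite add1n -Kj sum1_card; apply/subset_leq_card/subsetP => x; rewrite unfold_in => /andP[].
rewrite addn0 sum1_card leqNgt; apply: contra vKc => /card_gt1P.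
case=> x [y [xA yA xy]]; move: xA yA; rewrite !unfold_in /= => /and3P[xK _ xc] /and3P[yK _ yc].
have vz z : z \in K -> g v z.
  move=> zK; have vz : v != z by apply: contraNneq vK => ->.
  have [zx|zx] := eqVneq z x.
    apply: (cliqueP _ yc) => //; rewrite !inE ?eqxx //.
    by rewrite zK zx xy orbT.
  by apply: (cliqueP _ xc) => //; rewrite !inE ?eqxx // zK zx orbT.
apply/cliqueP => a b /setU1P[->|aK] /setU1P[->|bK]; rewrite ?eqxx // => ab.
- exact: vz.
- by rewrite gs vz.
- exact: (cliqueP _ Kc).
Qed.

Notation c j := #|faces clique j|.

Lemma sum_sqr_nat (I : finType) (A : {set I}) (F : I -> nat) :
  (\sum_(i in A) F i) ^ 2 <= #|A| * \sum_(i in A) F i ^ 2.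
Proof.
rewrite -(leq_pmul2l (isT : 0 < 2)).
rewrite -[_ ^ 2]mulnn big_distrlr /= big_distrr /=.
apply: (@leq_trans (\sum_(i in A) \sum_(j in A) (F i ^ 2 + F j ^ 2))).
  apply: leq_sum => i _; rewrite big_distrr /=; apply: leq_sum => j _.
  exact: nat_Cauchy.
under eq_bigr do rewrite big_split /= sum_nat_const.
by rewrite big_split /= sum_nat_const -big_distrr /= mul2n addnn.
Qed.

(** Cauchy-Schwarz for the extension numbers of the j-cliques; regrouping the sum of squares over
    (j+1)-cliques makes [sum_extensions_facets] applicable. *)
Lemma moon_moser j :
  (j.+1 * c j.+1) ^ 2 <= c j * (#|V| * c j.+1 + j * (j.+2 * c j.+2)).
Proof.
rewrite -sum_card_extensions; last exact: downclosed_clique.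
apply: leq_trans (sum_sqr_nat _ _) _; rewrite leq_mul2l; apply/orP; right.
rewrite -[j.+2 * _]sum_card_extensions; last exact: downclosed_clique.
under eq_bigr do rewrite -mulnn -[X in X * _]sum1_card big_distrl /=.
rewrite (sum_extensions _ (fun S _ => 1 * d S)); last exact: downclosed_clique.
rewrite [#|V| * _]mulnC -sum_nat_const big_distrr -big_split /=.
apply: leq_sum => K; rewrite inE => /andP[/eqP Kj Kc].
under eq_bigr do rewrite mul1n.
exact: sum_extensions_facets.
Qed.

(** Downward induction from j = l, where the left side vanishes: [moon_moser] turns the bound for j
    + 1 into that for j. Balanced complete l-partite graphs attain equality. *)
Lemma clique_ratio l j : c l.+1 = 0 -> j <= l ->
  j.+1 * l * c j.+1 <= (l - j) * #|V| * c j.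
Proof.
move=> cl jl; have [m] := ubnP (l - j); elim: m j jl => // m IH j jl jm.
have [jl'|] := ltnP j l; last first.
  move=> lj; have -> : j = l by lia.
  by rewrite cl muln0.
have [->|c0] := eqVneq (c j.+1) 0; first by rewrite muln0.
have h1 : j.+2 * l * c j.+2 <= (l - j.+1) * #|V| * c j.+1 by apply: IH => //; lia.
have h2 := moon_moser j.
rewrite -(leq_pmul2l (_ : 0 < j.+1 * c j.+1)) ?muln_gt0 ?lt0n //.
have h3 := leq_mul (leqnn (l : nat)) h2.
have h4 : l * (c j * (#|V| * c j.+1 + j * (j.+2 * c j.+2))) <=
  c j * (l * #|V| * c j.+1 + j * ((l - j.+1) * #|V| * c j.+1)).
  rewrite mulnCA leq_mul2l mulnDr mulnA leq_add2l mulnCA leq_mul2l.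
  by apply/orP; right; apply/orP; right; apply: leq_trans h1; rewrite mulnCA mulnA.
apply: leq_trans (_ : l * (j.+1 * c j.+1) ^ 2 <= _); first by apply/eq_leq; ring.
apply: (leq_trans h3); apply: (leq_trans h4); apply/eq_leq.
have -> : l = j.+1 + (l - j.+1) by lia.
set t := l - j.+1; have -> : j.+1 + t - j = t.+1 by lia.
have -> : j.+1 + t - j.+1 = t by lia.
ring.
Qed.

Lemma clique_upper_bound l j : c l.+1 = 0 -> j <= l.+1 ->
  j`! * l ^ j * c j <= l ^_ j * #|V| ^ j.
Proof.
move=> cl; elim: j => [|j IH] jl; first by rewrite !expn0 faces0 ?clique0.
have := clique_ratio cl jl; have := IH (ltnW jl).
rewrite factS ffactnSr !expnS => h1 h2.
have := leq_mul (leqnn (l - j)) (leq_mul (leqnn #|V|) h1).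
have := leq_mul (leqnn (j`! * l ^ j)) h2.
move=> h3 h4; apply: (@leq_trans (j`! * l ^ j * (j.+1 * l * c j.+1))).
  by apply/eq_leq; ring.
apply: (leq_trans h3); apply: leq_trans (_ : (l - j) * (#|V| * (j`! * l ^ j * c j)) <= _).
  by apply/eq_leq; ring.
by apply: (leq_trans h4); apply/eq_leq; ring.
Qed.

(** The product of the ratios from 2 upwards, stopping at the number of edges: this is what makes
    many large cliques force many edges. *)
Lemma clique_edge_bound l j : c l.+1 = 0 -> j.+2 <= l.+1 ->
  j.+2`! * l ^ j * c j.+2 <= 2 * (l - 2) ^_ j * #|V| ^ j * c 2.
Proof.
move=> cl; elim: j => [|j IH] jl; first by rewrite !expn0 !muln1.
have := @clique_ratio l j.+2 cl jl; have := IH (ltnW jl).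
rewrite (factS j.+2) ffactnSr !expnS => h1 h2.
have := leq_mul (leqnn (l - j.+2)) (leq_mul (leqnn #|V|) h1).
have := leq_mul (leqnn (j.+2`! * l ^ j)) h2.
move=> h3 h4; apply: (@leq_trans (j.+2`! * l ^ j * (j.+3 * l * c j.+3))).
  by apply/eq_leq; ring.
apply: (leq_trans h3); apply: leq_trans (_ : (l - j.+2) * (#|V| * (j.+2`! * l ^ j * c j.+2)) <= _).
  by apply/eq_leq; ring.
apply: (leq_trans h4); rewrite -subnDA add2n; apply/eq_leq; ring.
Qed.

End Complexes.

(** * Stability for graphs (Furedi) *)

Section Furedi.
Variables (V : finType) (g : rel V).
Hypotheses (gs : symmetric g) (gi : irreflexive g).
Implicit Types A B K : {set V}.

Lemma big_setID2 A B (F : V -> V -> nat) : B \subset A ->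
  \sum_(u in A) \sum_(v in A) F u v =
  \sum_(u in B) \sum_(v in B) F u v + \sum_(u in B) \sum_(v in A :\: B) F u v +
  (\sum_(u in A :\: B) \sum_(v in B) F u v +
   \sum_(u in A :\: B) \sum_(v in A :\: B) F u v).
Proof.
move=> BA; rewrite (big_setID B) /= (setIidPr BA) -!big_split /=.
by congr (_ + _); apply: eq_bigr => u _; rewrite (big_setID B) /= (setIidPr BA).
Qed.

(* Furedi's proof of stability: the colour classes are successively
   non-neighbourhoods of vertices of maximum degree. *)
Lemma furedi_on l A :
  (forall K, K \subset A -> #|K| = l.+1 -> ~~ clique g K) ->
  exists c : V -> nat, {in A, forall v, c v < l} /\
    \sum_(u in A) \sum_(v in A) g u v +
    \sum_(u in A) \sum_(v in A) (g u v && (c u == c v)) <=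
    \sum_(u in A) \sum_(v in A) (c u != c v).
Proof.
elim: l A => [|l IH] A hA.
  have A0 x : x \notin A.
    apply/negP => xA; have /negP[] : ~~ clique g [set x].
      by apply: hA; rewrite ?cards1 ?sub1set.
    by apply/cliqueP => u v /set1P-> /set1P->; rewrite eqxx.
  exists (fun=> 0); split=> [x|]; first by rewrite (negPf (A0 x)).
  by rewrite !big1 // => u; rewrite (negPf (A0 u)).
have [->|/set0Pn[x0 x0A]] := eqVneq A set0.
  by exists (fun=> 0); split=> [x|]; rewrite ?inE // !big_set0.
case: (@arg_maxnP _ x0 (mem A) (fun u => \sum_(v in A) g u v) x0A) => x.
rewrite -[mem A x]/(x \in A) => xA xmax.
pose B := [set v in A | g x v]; have BA : B \subset A by apply/subsetP => v /setIdP[].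
have xdeg : \sum_(v in A) g x v = #|B|.
  rewrite -sum1_card big_mkcond /= [RHS]big_mkcond /=; apply: eq_bigr => v _.
  by rewrite inE; case: (v \in A); case: (g x v).
have [|c [cl hc]] := IH B.
  move=> K KB Kl; apply/negP => Kc.
  have xK : x \notin K by apply/negP => /(subsetP KB); rewrite inE gi andbF.
  have /negP[] : ~~ clique g (x |: K).
    apply: hA; first by rewrite subUset sub1set xA (subset_trans KB BA).
    by rewrite cardsU1 xK Kl.
  have xv v : v \in K -> g x v by move=> /(subsetP KB); rewrite inE => /andP[].
  apply/cliqueP => u v /setU1P[->|uK] /setU1P[->|vK] uv.
  - by rewrite eqxx in uv.
  - exact: xv.
  - by rewrite gs xv.
  - by apply: (cliqueP _ _ Kc).
pose c' v := if v \in B then c v else l.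
have c'B v : v \in B -> c' v = c v by rewrite /c' => ->.
have c'D v : v \in A :\: B -> c' v = l by rewrite /c' inE => /andP[/negPf->].
exists c'; split=> [v vA|].
  by rewrite /c'; case: ifP => // /cl/ltnW; rewrite ltnS.
rewrite !(big_setID2 _ BA).
have e1 : \sum_(u in B) \sum_(v in B) (g u v && (c' u == c' v)) =
          \sum_(u in B) \sum_(v in B) (g u v && (c u == c v)).
  by apply: eq_bigr => u uB; apply: eq_bigr => v vB; rewrite !c'B.
have e2 : \sum_(u in B) \sum_(v in B) (c' u != c' v) =
          \sum_(u in B) \sum_(v in B) (c u != c v).
  by apply: eq_bigr => u uB; apply: eq_bigr => v vB; rewrite !c'B.
have ne u v : u \in B -> v \in A :\: B -> (c' u == c' v) = false.
  by move=> uB vD; rewrite c'B // c'D // ltn_eqF ?cl.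
have e3 : \sum_(u in B) \sum_(v in A :\: B) (g u v && (c' u == c' v)) = 0.
  by apply: big1 => u uB; apply: big1 => v vD; rewrite ne // andbF.
have e4 : \sum_(u in A :\: B) \sum_(v in B) (g u v && (c' u == c' v)) = 0.
  by apply: big1 => u uB; apply: big1 => v vD; rewrite eq_sym ne // andbF.
have e5 : \sum_(u in A :\: B) \sum_(v in A :\: B) (g u v && (c' u == c' v)) =
          \sum_(u in A :\: B) \sum_(v in A :\: B) g u v.
  by apply: eq_bigr => u uD; apply: eq_bigr => v vD; rewrite !c'D // eqxx andbT.
have e6 : \sum_(u in B) \sum_(v in A :\: B) (c' u != c' v) = #|B| * #|A :\: B|.
  rewrite -sum_nat_const; apply: eq_bigr => u uB; rewrite -sum1_card.
  by apply: eq_bigr => v vD; rewrite ne.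
have e7 : \sum_(u in A :\: B) \sum_(v in B) (c' u != c' v) = #|A :\: B| * #|B|.
  rewrite -sum_nat_const; apply: eq_bigr => u uB; rewrite -sum1_card.
  by apply: eq_bigr => v vD; rewrite eq_sym ne.
have e8 : \sum_(u in B) \sum_(v in A :\: B) g u v =
          \sum_(u in A :\: B) \sum_(v in B) g u v.
  by rewrite exchange_big; apply: eq_bigr => u _; apply: eq_bigr => v _; rewrite gs.
(* The left side is the degree sum over A minus B, and no degree exceeds that of x, which is |B|.
   Used twice, the bound pays for the edges at the new class and for its monochromatic edges. *)
have e9 : \sum_(u in A :\: B) \sum_(v in B) g u v +
          \sum_(u in A :\: B) \sum_(v in A :\: B) g u v <= #|A :\: B| * #|B|.
  rewrite -big_split /= -sum_nat_const; apply: leq_sum => u /setDP[uA _].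
  rewrite -xdeg; apply: leq_trans (xmax u uA).
  by rewrite [X in _ <= X](big_setID B) /= (setIidPr BA).
rewrite e1 e2 e3 e4 e5 e6 e7 e8.
move: hc e9; set a := \sum_(u in B) _; set b := \sum_(u in B) _.
set a1 := \sum_(u in _ :\: _) _; set a2 := \sum_(u in _ :\: _) _.
set b1 := \sum_(u in B) _; lia.
Qed.

Lemma furedi l : #|faces (clique g) l.+1| = 0 ->
  exists c : V -> 'I_l,
    \sum_u \sum_v g u v + \sum_u \sum_v (g u v && (c u == c v)) <=
    \sum_u \sum_v (c u != c v).
Proof.
move=> cl; have [K _ Kl|c [cT hc]] := @furedi_on l setT.
  apply/negP => Kc; move/eqP: cl; rewrite cards_eq0 => /eqP/setP/(_ K).
  by rewrite !inE Kl eqxx Kc.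
have cl' v : c v < l by apply: cT; rewrite inE.
exists (fun v => Ordinal (cl' v)); move: hc.
have sumT F : \sum_(u in [set: V]) \sum_(v in [set: V]) F u v = \sum_u \sum_v F u v :> nat.
  rewrite (eq_bigl xpredT) => [|u]; last by rewrite inE.
  by apply: eq_bigr => u _; apply: eq_bigl => v; rewrite inE.
by rewrite !sumT.
Qed.

Lemma sum_rel_faces2 : \sum_u \sum_v g u v = 2 * #|faces (clique g) 2|.
Proof.
rewrite -sum_card_extensions; last exact: downclosed_clique.
have -> : faces (clique g) 1 = [set [set x] | x : V].
  apply/setP => S; rewrite inE; apply/andP/imsetP => [[/cards1P[x ->] _]|[x _ ->]].
    by exists x.
  by rewrite cards1; split=> //; apply/cliqueP => u v /set1P-> /set1P->; rewrite eqxx.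
rewrite big_imset /=; last by move=> x y _ _; apply: set1_inj.
apply: eq_big => // x _; rewrite -sum1_card [RHS]big_mkcond /=.
apply: eq_bigr => y _; rewrite !inE; case: eqVneq => [->|yx]; first by rewrite gi.
rewrite /=; congr (nat_of_bool _); apply/idP/idP => [xy|/cliqueP h].
  apply/cliqueP => u v /set2P[->|->] /set2P[->|->]; rewrite ?eqxx //.
  by rewrite gs.
by apply: h; rewrite ?inE ?eqxx ?orbT // eq_sym.
Qed.

End Furedi.

(** * Crossing sets of a colouring *)

Section Crossing.
Variables (V : finType) (l : nat) (c : V -> 'I_l).
Implicit Types (A S : {set V}).

(** Crossing k-sets are encoded as k-cliques of the complete multipartite graph of [c], so the
    clique counts apply to them. *)
Definition cross k := faces (clique (fun u v => c u != c v)) k.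
Definition color_class i := [set v | c v == i].

Lemma neq_color_sym : symmetric (fun u v => c u != c v).
Proof. by move=> u v; rewrite eq_sym. Qed.

Lemma crossP k S :
  reflect (#|S| = k /\ {in S &, injective c}) (S \in cross k).
Proof.
rewrite inE; apply: (iffP andP) => [[/eqP Sk /cliqueP h]|[Sk h]]; split=> //.
- by move=> x y xS yS /eqP; apply: contraTeq; apply: h.
- by apply/eqP.
- by apply/cliqueP => x y xS yS; apply: contraNneq => /h ->.
Qed.

Lemma cross_big k : l < k -> #|cross k| = 0.
Proof.
move=> lk; apply/eqP; rewrite cards_eq0; apply/eqP/setP => S; rewrite in_set0.
apply/negP => /crossP[Sk /card_in_imset cS].
by have := max_card (mem (c @: S)); rewrite cS Sk card_ord leqNgt lk.
Qed.

Lemma card_cross_le k : k <= l.+1 -> k`! * l ^ k * #|cross k| <= l ^_ k * #|V| ^ k.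
Proof.
apply: clique_upper_bound; first exact: neq_color_sym.
exact: cross_big.
Qed.

Lemma sum_color_class : \sum_i #|color_class i| = #|V|.
Proof.
rewrite -sum1_card (partition_big c xpredT) //=; apply: eq_bigr => i _.
by rewrite -sum1_card; apply: eq_bigl => v; rewrite inE.
Qed.

Lemma sum_neq_color :
  \sum_u \sum_v (c u != c v) + \sum_i #|color_class i| ^ 2 = #|V| ^ 2.
Proof.
have -> : \sum_i #|color_class i| ^ 2 = \sum_u \sum_v (c u == c v).
  rewrite [RHS](partition_big c xpredT) //=; apply: eq_bigr => i _.
  rewrite -mulnn -sum_nat_const; apply: eq_big => [u|u /[!inE] /eqP ui].
    by rewrite inE.
  rewrite -sum1_card big_mkcond /=; apply: eq_bigr => v _.
  by rewrite inE ui eq_sym; case: eqP.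
rewrite -big_split /= -mulnn -sum_nat_const; apply: eq_bigr => u _.
rewrite -big_split /= -sum1_card; apply: eq_bigr => v _.
by case: eqP.
Qed.

Lemma card_cross_sup_ge q a m A : A \in cross a -> (forall i, q <= #|color_class i|) ->
  (l - a) ^_ m * q ^ m <= m`! * #|[set e in cross (a + m) | A \subset e]|.
Proof.
move=> /crossP[Aa Ai] hq.
pose P : pred {set V} := fun S => [disjoint A & S] && clique (fun u v => c u != c v) (A :|: S).
have Pd : downclosed P.
  move=> S K SK /andP[AK PK]; apply/andP; split; first exact: disjointWr AK.
  by apply: downclosed_clique PK; apply: setUS.
have P0 : P set0.
  rewrite /P -setI_eq0 setI0 eqxx setU0; apply/cliqueP => x y xA yA.
  by apply: contraNneq => /Ai ->.
have := @faces_lower_bound V P (fun j => (l - a - j) * q) m Pd P0.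
have -> : \prod_(j < m) ((l - a - j) * q) = (l - a) ^_ m * q ^ m.
  by rewrite big_split /= prod_nat_const card_ord ffact_prod.
move=> h; apply: leq_trans (h _) _ => {h}.
  move=> S _ /andP[AS /cliqueP ASc].
  have ASi : {in A :|: S &, injective c}.
    by move=> x y xS yS /eqP; apply: contraTeq; apply: ASc.
  rewrite (_ : _ * q = \sum_(i in ~: (c @: (A :|: S))) q); last first.
    rewrite sum_nat_const (cardsCs (~: _)) setCK card_in_imset // card_ord cardsU.
    by rewrite (disjoint_setI0 AS) cards0 subn0 Aa subnDA.
  apply: (@leq_trans (\sum_(i in ~: (c @: (A :|: S))) #|color_class i|)).
    by apply: leq_sum.
  rewrite -sum1_card (partition_big c (mem (~: (c @: (A :|: S))))) /=; last first.
    move=> x; rewrite !inE => /and3P[xS Ax /cliqueP xc].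
    apply/negP => /imsetP[y yAS xy].
    have yx : x != y.
      apply: contraTneq yAS => <-; rewrite inE (negPf xS) orbF.
      by move: Ax; rewrite disjoint_sym disjoints_subset subUset sub1set inE => /andP[].
    move: (xc x y) yAS; rewrite !inE eqxx /= orbT xy eqxx => h.
    by case/orP=> yy; move: (h isT); rewrite yy ?orbT yx => /(_ isT isT).
  apply: leq_sum => i iAS; rewrite -sum1_card.
  rewrite big_mkcond [X in _ <= X]big_mkcond /=; apply: leq_sum => x _.
  rewrite !inE; case: eqP => // xi; rewrite andbT.
  have xAS : x \notin A :|: S.
    by apply: contraTN iAS => xAS; rewrite inE negbK -xi imset_f.
  have [xA xS] : x \notin A /\ x \notin S by apply/andP; rewrite -negb_or -in_setU.
  rewrite xS /=; case: ifP => // /negP[]; apply/andP; split.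
    by rewrite disjoint_sym disjoints_subset subUset sub1set inE xA -disjoints_subset disjoint_sym.
  rewrite setUCA; apply/cliqueP => u v /setU1P[->|uAS] /setU1P[->|vAS] uv.
  - by rewrite eqxx in uv.
  - by apply: contraTneq iAS => cc; rewrite inE negbK -xi cc imset_f.
  - by apply: contraTneq iAS => cc; rewrite inE negbK -xi -cc imset_f.
  - exact: ASc.
rewrite leq_mul2l -(@card_in_imset _ _ (setU A)).
  apply/orP; right; apply/subset_leq_card/subsetP => x /imsetP[S].
  rewrite !inE => /andP[/eqP Sm /andP[AS ASc]] ->.
  by rewrite subsetUl ASc cardsU (disjoint_setI0 AS) cards0 subn0 Aa Sm eqxx.
have AK (K : {set V}) x : [disjoint A & K] -> x \in K -> (x \in A) = false.
  by move=> AK xK; apply: contraTF AK => xA; apply/pred0Pn; exists x; rewrite /= xA.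
move=> S K; rewrite !inE => /and3P[_ AS _] /and3P[_ AK' _] ASK.
apply/setP => x; apply/idP/idP => xS.
  have : x \in A :|: K by rewrite -ASK inE xS orbT.
  by rewrite inE (AK _ _ AS xS).
have : x \in A :|: S by rewrite ASK inE xS orbT.
by rewrite inE (AK _ _ AK' xS).
Qed.

Lemma card_cross_ge q k : (forall i, q <= #|color_class i|) ->
  l ^_ k * q ^ k <= k`! * #|cross k|.
Proof.
move=> hq; have /card_cross_sup_ge h0 : set0 \in cross 0.
  by apply/crossP; rewrite cards0; split=> // x; rewrite inE.
have := h0 q k hq; rewrite subn0 add0n => /leq_trans; apply.
rewrite leq_mul2l; apply/orP; right; apply/subset_leq_card/subsetP => e.
by rewrite inE => /andP[].
Qed.

(** Two of the l + 1 core vertices get the same colour, and some edge contains both. *)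
Lemma cross_free k (E : {set {set V}}) : E \subset cross k ->
  ~~ contains (Hypergraph E) (expanded_clique k l.+1).
Proof.
move=> Ec; apply/negP => /existsP[f /andP[/injectiveP fi /forall_inP fE]].
have /injectivePn[i [j ij cij]] : ~~ injectiveb (fun i : 'I_l.+1 => c (f (inl i))).
  by apply/negP => /injectiveP/leq_card; rewrite !card_ord ltnn.
have c2 : #|[set i; j]| == 2 by rewrite cards2 ij.
pose e0 : clique_edge l.+1 := exist _ [set i; j] c2.
have /fE : (inl @: val e0) :|: [set inr (e0, t) | t : 'I_(k - 2)] \in
  edges (expanded_clique k l.+1) by apply: imset_f.
move=> /(subsetP Ec)/crossP[_ ci].
have fin x : x \in [set i; j] -> f (inl x) \in
   [set f x | x in (inl @: val e0) :|: [set inr (e0, t) | t : 'I_(k - 2)]].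
  by move=> xij; apply/imset_f; rewrite inE imset_f.
have /fi[ij'] := ci _ _ (fin i (set21 _ _)) (fin j (set22 _ _)) cij.
by rewrite ij' eqxx in ij.
Qed.

End Crossing.

(** * Heavy pairs in hypergraphs without an expanded clique *)

Section Free.
Variables (V : finType) (k l : nat) (E : {set {set V}}).
Hypotheses (Ek : uniform k E)
  (Ef : ~~ contains (Hypergraph E) (expanded_clique k l.+1)).
Notation hv := (heavy k l.+1 E).
Notation W := (nvertices k l.+1).

Lemma heavy_clique_free : #|faces (clique hv) l.+1| = 0.
Proof.
apply/eqP; rewrite cards_eq0; apply/eqP/setP => K; rewrite !inE.
apply: contraNF Ef => /andP[/eqP Kl /cliqueP Kc].
pose w (i : 'I_l.+1) := enum_val (cast_ord (esym Kl) i).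
have wi : injective w by move=> i j /enum_val_inj/cast_ord_inj.
have [||h hh] := @expansion_complete V k l.+1 E Ek w wi set0 (fun=> set0) _ _;
    last exact: (expansion_contains Ek wi hh).
  by split=> [e|e f]; rewrite !inE.
by move=> e i j _ _ ij; apply: Kc; rewrite ?enum_valP ?(inj_eq wi).
Qed.

(** An edge that is not a clique of heavy pairs contains a light pair, and a light pair lies in few
    edges. *)
Lemma light_edges_bound :
  #|E :\: faces (clique hv) k| <= #|V| ^ 2 * (W * #|V| ^ (k - 3)).
Proof.
rewrite -mulnn -[#|V| * #|V|]card_prod.
apply: leq_trans (@card_exists_le _ _
  [set q : V * V | (q.1 != q.2) && ~~ hv q.1 q.2]
  (fun q => [set e in E | (q.1 \in e) && (q.2 \in e)]) _ (W * #|V| ^ (k - 3)) _ _) _.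
- move=> e /[!inE] /andP[+ eE]; rewrite (uniformP _ _ Ek _ eE) eqxx /=.
  case/forall_inPn => u ue /forall_inPn[v ve]; rewrite negb_imply => uv.
  by exists (u, v); rewrite !inE /= ?uv // eE ue.
- by move=> [u v] /[!inE] /= /andP[uv]; rewrite /heavy uv /= -leqNgt.
- by rewrite leq_mul2r max_card orbT.
Qed.

(** A non-crossing edge contains a light pair or a monochromatic heavy pair; pairs of the second
    kind are what [furedi] bounds. *)
Lemma noncross_bound (c : V -> 'I_l) :
  #|E :\: cross c k| <= #|V| ^ 2 * (W * #|V| ^ (k - 3)) +
    (\sum_u \sum_v (hv u v && (c u == c v))) * #|V| ^ (k - 2).
Proof.
rewrite -(setID (E :\: _) (faces (clique hv) k)).
apply: leq_trans (leq_card_setU _ _) _; rewrite addnC leq_add //.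
  apply: leq_trans light_edges_bound; apply/subset_leq_card/setSD/subsetDl.
have -> : \sum_u \sum_v (hv u v && (c u == c v)) =
    #|[set q : V * V | hv q.1 q.2 && (c q.1 == c q.2)]|.
  rewrite pair_bigA /= -sum1_card [RHS]big_mkcond /=.
  by apply: eq_bigr => q _; rewrite inE; case: andb.
apply: (@card_exists_le _ _ _ (fun q => [set e in E | (q.1 \in e) && (q.2 \in e)])).
  move=> e /[!inE] /andP[/andP[+ eE] /andP[_ /cliqueP ec]].
  move/uniformP: (Ek) => /(_ _ eE) ek.
  rewrite ek eqxx /= => /forall_inPn[u ue /forall_inPn[v ve]].
  rewrite negb_imply negbK => /andP[uv cuv].
  by exists (u, v); rewrite !inE /= ?cuv ?ec // eE ue.
move=> [u v] /[!inE] /= /andP[/andP[uv _] _]; exact: cod_le.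
Qed.

End Free.

(** * Stability for expanded cliques *)

Section Stability.
Local Open Scope ring_scope.
Variable R : realType.

Lemma exists_nat_ge (x : R) : exists n0 : nat, forall n, (n0 <= n)%N -> x <= n%:R.
Proof.
exists (Num.bound `|x|) => n n0n.
apply: (le_trans (ler_norm x)); apply: (le_trans (ltW (archi_boundP (normr_ge0 x)))).
by rewrite ler_nat.
Qed.

(* The limit of e(G) / n^k for balanced complete l-partite k-graphs G. *)
Definition density k l : R := (l ^_ k)%:R / (k`! * l ^ k)%:R.

(** Putting the Turan number (1 - 1/l) n^2 of ordered edges into [clique_edge_bound] gives exactly
    the limit density, so near-equality passes from k-cliques to edges. *)
Lemma density_step k l :
  density k.+2 l.+2 * (k.+2`! * l.+2 ^ k)%:R = (l ^_ k)%:R * (1 - l.+2%:R^-1).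
Proof.
rewrite /density !ffactSS !expnS.
have := fact_gt0 k.+2; have : (0 < l.+2 ^ k)%N by rewrite expn_gt0.
move: (k.+2`!) (l.+2 ^ k)%N => f p p0 f0; rewrite !natrM.
have -> : l.+1%:R = l.+2%:R - 1 :> R by rewrite -[l.+2%:R]natr1 addrK.
have {}f0 : f%:R != 0 :> R by rewrite pnatr_eq0 -lt0n.
have {}p0 : p%:R != 0 :> R by rewrite pnatr_eq0 -lt0n.
have l0 : l.+2%:R != 0 :> R by rewrite pnatr_eq0.
move: f0 p0 l0; move: (f%:R : R) (p%:R : R) (l.+2%:R : R) ((l ^_ k)%:R : R).
by move=> {}f {}p m a f0 p0 m0; field; rewrite f0 p0 m0.
Qed.

Lemma density_gt0 k l : (k <= l)%N -> (0 < k)%N -> 0 < density k l.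
Proof.
move=> kl k0; apply: divr_gt0; rewrite ltr0n ?ffact_gt0 //.
by rewrite muln_gt0 fact_gt0 expn_gt0 (leq_trans k0).
Qed.

Lemma card_cross_le_density (V : finType) l (c : V -> 'I_l) k : (k <= l)%N -> (0 < k)%N ->
  #|cross c k|%:R <= density k l * #|V|%:R ^+ k.
Proof.
move=> kl k0; have := card_cross_le c (leqW kl).
rewrite /density mulrAC ler_pdivlMr ?ltr0n; last first.
  by rewrite muln_gt0 fact_gt0 expn_gt0 (leq_trans k0).
by rewrite -natrX -!natrM ler_nat mulnC.
Qed.

(** The right side is the sum of all squared deviations from the mean. *)
Lemma sum_sqr_dev l (x : 'I_l -> R) (i : 'I_l) :
  (x i - (\sum_j x j) / l%:R) ^+ 2 <= \sum_j x j ^+ 2 - (\sum_j x j) ^+ 2 / l%:R.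
Proof.
have l0 : l%:R != 0 :> R by rewrite pnatr_eq0 -lt0n (leq_trans _ (ltn_ord i)).
set s := \sum_j x j; set m := s / l%:R.
apply: (@le_trans _ _ (\sum_j (x j - m) ^+ 2)).
  by rewrite (bigD1 i) //= lerDl sumr_ge0 // => j _; rewrite sqr_ge0.
rewrite le_eqVlt; apply/orP; left; apply/eqP.
under eq_bigr do rewrite sqrrB.
rewrite big_split /= sumrB sumr_const card_ord sumrMnl.
rewrite -mulr_suml -/s -[_ *+ l]mulr_natr /m; field.
exact: l0.
Qed.

Lemma stability k l (eps : R) : (2 < k)%N -> (k <= l)%N -> 0 < eps ->
  exists (delta : R) (n0 : nat), 0 < delta /\
  forall (V : finType) (E : {set {set V}}), uniform k E ->
    ~~ contains (Hypergraph E) (expanded_clique k l.+1) -> (n0 <= #|V|)%N ->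
    (density k l - delta) * #|V|%:R ^+ k <= #|E|%:R ->
  exists c : V -> 'I_l,
    #|cross c k :\: E|%:R <= eps * #|V|%:R ^+ k /\
    forall i, `| #|color_class c i|%:R - #|V|%:R / l%:R | <= eps * #|V|%:R.
Proof.
move=> k3 kl eps0.
have k2 : (k - 2).+2 = k by lia.
have l2 : (l - 2).+2 = l by lia.
have k32 : (k - 3).+1 = (k - 2)%N by lia.
pose W := nvertices k l.+1.
pose a := ((l - 2) ^_ (k - 2))%N; have a0 : 0 < a%:R :> R.
  by rewrite ltr0n ffact_gt0; lia.
pose D := (k`! * l ^ (k - 2))%N; pose C1 : R := D%:R / a%:R.
have hD : density k l * D%:R = a%:R * (1 - l%:R^-1).
  by have := density_step (k - 2) (l - 2); rewrite k2 l2.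
have C10 : 0 <= C1 by rewrite divr_ge0 ?ler0n.
(* Half of [eta] is the permitted deficit in edges, the other half pays for the light edges.
   Moon-Moser turns the resulting deficit [eta * n ^ k] in k-cliques into [C1 * eta * n ^ 2] in
   ordered heavy pairs, which bounds the monochromatic heavy pairs and the variance of the class
   sizes. The deviation of one class needs a square root, hence [eps ^+ 2]. *)
pose eta := Num.min eps (eps ^+ 2) / (1 + C1).
have C11 : 0 < 1 + C1 by lra.
have eta0 : 0 < eta by rewrite divr_gt0 // lt_min eps0 exprn_gt0.
have etaE : eta * (1 + C1) = Num.min eps (eps ^+ 2) by rewrite /eta divfK // gt_eqF.
have eta1 : eta + C1 * eta <= eps by rewrite -[X in X + _]mulr1 [C1 * _]mulrC -mulrDr etaE ge_min lexx.
have eta2 : C1 * eta <= eps ^+ 2.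
  apply: (@le_trans _ _ (eta * (1 + C1))); first by nra.
  by rewrite etaE ge_min lexx orbT.
have C1a : C1 * a%:R = D%:R by rewrite /C1 divfK // gt_eqF.
clearbody eta C1.
have eta02 : 0 < eta / 2%:R by rewrite divr_gt0 ?ltr0n.
have [n0 hn0] := exists_nat_ge (W%:R / (eta / 2%:R)).
exists (eta / 2%:R), n0.+1; split=> //.
move=> V E Ek Ef n0V hE; set n := #|V| in n0V hE *.
have n0' : (0 < n)%N by apply: leq_ltn_trans n0V.
have n_gt0 : 0 < n%:R :> R by rewrite ltr0n.
have Wn : W%:R <= eta / 2%:R * n%:R.
  have := hn0 n (ltnW n0V); rewrite ler_pdivrMr // mulrC; exact.
have hs := @heavy_sym V k l.+1 E; have hi := @heavy_irr V k l.+1 E.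
have [c hc] := furedi hs hi (heavy_clique_free Ek Ef).
exists c.
have hN := noncross_bound Ek c; have hL := @light_edges_bound V k l E Ek.
move: hc; rewrite sum_rel_faces2 //.
move: hN; set inner := (\sum_u \sum_v _)%N; set crs := (\sum_u \sum_v (c u != c v))%N.
rewrite -/n -/W in hL *.
set f2 := #|faces _ 2| => hN hc.
have := @clique_edge_bound V _ hs l (k - 2) (heavy_clique_free Ek Ef).
rewrite -/n -/f2 k2 -/a -/D.
set fk := #|faces _ k| => /(_ (leqW kl)) hF.
move: hF hN; set y := (n ^ (k - 2))%N => hF hN; have y0 : 0 < y%:R :> R by rewrite ltr0n expn_gt0 n0'.
have n3 : (n ^ 2 * (W * n ^ (k - 3)) = W * n * y)%N.
  by rewrite /y -k32 [in RHS]expnS -mulnn; ring.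
have nk : (n ^ k = n ^ 2 * y)%N by rewrite /y -expnD add2n k2.
rewrite n3 in hL hN.
have hE' : (#|E| <= W * n * y + fk)%N.
  rewrite -(cardsID (faces (clique (heavy k l.+1 E)) k) E) addnC leq_add //.
  by rewrite subset_leq_card ?subsetIr.
have hM : (#|cross c k :\: E| + #|E| = #|cross c k| + #|E :\: cross c k|)%N.
  by rewrite -(cardsID E (cross c k)) -(cardsID (cross c k) E) setIC; ring.
have hS : (crs + \sum_i #|color_class c i| ^ 2 = n ^ 2)%N.
  exact: sum_neq_color.
have hC := card_cross_le_density c kl (ltnW (ltnW k3)); rewrite -/n -natrX nk in hC.
have hsum := sum_color_class c; rewrite -/n in hsum.
clearbody y W D a n.
rewrite -natrX nk natrM in hE.
move: hE' hF hc hN hM hS; rewrite -!(ler_nat R) => A1 A2 A3 A5.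
move=> /(congr1 (fun m => m%:R : R)) A6 /(congr1 (fun m => m%:R : R)) A4.
move: A1 A2 A3 A4 A5 A6.
rewrite /= !natrD !natrM -C1a.
have -> : (\sum_i #|color_class c i| ^ 2)%N%:R = \sum_i #|color_class c i|%:R ^+ 2 :> R.
  by rewrite natr_sum; apply: eq_bigr => i _; rewrite natrX.
move=> A1 A2 A3 A4 A5 A6.
rewrite natrM natrX in hC; rewrite natrX in hE.
have nkR : n%:R ^+ k = n%:R ^+ 2 * y%:R :> R by rewrite -natrX nk natrM natrX.
have dev i := sum_sqr_dev (fun i => #|color_class c i|%:R : R) i.
move: dev; rewrite -natr_sum hsum nkR => dev.
have i_ge0 := ler0n R inner.
move: i_ge0 A1 A2 A3 A4 A5 A6 hC hE dev; rewrite addr0.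
move: (#|E|%:R : R) (fk%:R : R) (f2%:R : R) (inner%:R : R) (crs%:R : R) => e f f' i c'.
move: (#|_ :\: cross _ _|%:R : R) (#|cross _ _|%:R : R) (#|_ :\: E|%:R : R) => non cro mis.
move: hD; rewrite -C1a; move: (density k l) => dens hD; clear C1a hn0 n0V n0' n3 nk nkR hL hsum.
move: y0 n_gt0 Wn a0 hD; move: (y%:R : R) (n%:R : R) (W%:R : R) (a%:R : R) => {}y {}n {}W {}a.
move: (l%:R^-1 : R) (\sum_j _ : R) => il s y0 n_gt0 Wn a0 hD i_ge0 A1 A2 A3 A4 A5 A6 hC hE dev.
have ny0 : 0 < n * y by rewrite mulr_gt0.
have wy : W * n * y <= eta / 2 * (n ^+ 2 * y).
  by have := ler_wpM2r (ltW ny0) Wn; rewrite mulrA => /le_trans; apply; lra.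
have hf2 : (1 - il) * n ^+ 2 - C1 * eta * n ^+ 2 <= f' + f'.
  rewrite -(ler_pM2l (mulr_gt0 a0 y0)).
  have h : (dens - eta) * (n ^+ 2 * y) <= f by lra.
  have := ler_wpM2l (mulr_ge0 C10 (ltW a0)) h.
  have -> : C1 * a * ((dens - eta) * (n ^+ 2 * y)) =
     dens * (C1 * a) * (n ^+ 2 * y) - C1 * a * eta * (n ^+ 2 * y) by ring.
  by rewrite hD; lra.
have s_ge : n ^+ 2 * il <= s.
  have l0 : (0 < l)%N := leq_trans (ltnW (ltnW k3)) kl.
  by have := dev (Ordinal l0); have := sqr_ge0 (#|color_class c (Ordinal l0)|%:R - n * il); lra.
have hi' : i <= C1 * eta * n ^+ 2 by lra.
split.
  have iy := ler_wpM2r (ltW y0) hi'.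
  have := ler_wpM2r (ltW (mulr_gt0 n_gt0 ny0)) eta1; lra.
move=> j; have nn0 : 0 <= eps * n by rewrite mulr_ge0 ?ltW.
rewrite -(@ler_pXn2r _ 2%N) ?nnegrE // real_normK ?num_real //.
apply: le_trans (dev j) _.
have := ler_wpM2r (sqr_ge0 n) eta2; lra.
Qed.
End Stability.

(** * Extremal graphs are l-partite *)

Section Degrees.
Variable V : finType.
Implicit Types (S : {set V}) (E D : {set {set V}}).

Lemma sum_deg k E : uniform k E -> \sum_v deg E v = #|E| * k.
Proof.
move=> /uniformP Ek; rewrite -sum_nat_const.
under eq_bigr do rewrite /deg -sum1_card big_mkcond.
rewrite exchange_big [RHS]big_mkcond /=; apply: eq_bigr => e _.
rewrite (eq_bigr (fun v => (e \in E) && (v \in e) : nat)); last first.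
  by move=> v _; rewrite inE; case: andP.
case: (boolP (e \in E)) => eE /=; last by rewrite big1.
by rewrite -(Ek _ eE) -sum1_card [RHS]big_mkcond.
Qed.

Lemma sum_cod_le k D S v : uniform k D -> \sum_(u in S) cod D v u <= k * deg D v.
Proof.
move=> /uniformP Dk.
under eq_bigr do rewrite /cod -sum1_card big_mkcond.
rewrite exchange_big mulnC /deg -sum_nat_const [X in _ <= X]big_mkcond /=.
apply: leq_sum => e _; rewrite inE.
rewrite (eq_bigr (fun u => [&& e \in D, v \in e & u \in e] : nat)); last first.
  by move=> u _; rewrite inE; case: and3P.
case: (boolP (e \in D)) => eD /=; last by rewrite big1.
case: (v \in e) => /=; last by rewrite big1.
rewrite -(Dk _ eD) -sum1_card big_mkcond [X in _ <= X]big_mkcond /=.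
by apply: leq_sum => u _; case: (u \in S); case: (u \in e).
Qed.

Lemma card_deg_gt (R : realType) k D (t : R) : uniform k D ->
  (#|[set v | t < (deg D v)%:R]|%:R * t <= #|D|%:R * k%:R)%R.
Proof.
move=> Dk; rewrite -natrM -(sum_deg Dk) natr_sum mulr_natl -sumr_const big_mkcond /=.
by apply: ler_sum => v _; rewrite inE; case: ifP => [/ltW//|]; rewrite ler0n.
Qed.

Lemma cross_uniform l (c : V -> 'I_l) k : uniform k (cross c k).
Proof. by apply/uniformP => e /crossP[]. Qed.

Lemma uniformS k E D : D \subset E -> uniform k E -> uniform k D.
Proof. by move=> /subsetP DE /uniformP Ek; apply/uniformP => e /DE /Ek. Qed.

(** Greedy choice class by class: fewer than l earlier vertices exclude at most b candidates each.
    The predicate [Q] allows a class to be skipped. *)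
Lemma select_core (hv : rel V) l (Q : pred 'I_l) (C : 'I_l -> {set V}) b (z : V) :
  symmetric hv ->
  (forall i j v, Q i -> Q j -> i != j -> v \in C i -> #|[set u in C j | ~~ hv v u]| <= b) ->
  (forall i, Q i -> l * b < #|C i|) ->
  exists w : 'I_l -> V, (forall i, Q i -> w i \in C i) /\
    (forall i j, Q i -> Q j -> i != j -> hv (w i) (w j)).
Proof.
move=> hs hb hC.
suff h m : m <= l -> exists w : 'I_l -> V, (forall i : 'I_l, i < m -> Q i -> w i \in C i) /\
    (forall i j : 'I_l, i < m -> j < m -> Q i -> Q j -> i != j -> hv (w i) (w j)).
  by have [w [w1 w2]] := h l (leqnn l); exists w; split=> *; [apply: w1|apply: w2].
elim: m => [|m IH] ml; first by exists (fun=> z).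
have [w [w1 w2]] := IH (ltnW ml); pose i0 := Ordinal ml.
have [Qi0|nQ] := boolP (Q i0); last first.
  have lt (i : 'I_l) : Q i -> i < m.+1 -> i < m.
    rewrite ltnS leq_eqVlt => Qi /orP[/eqP im|//]; case/negP: nQ.
    by rewrite (_ : i0 = i) //; apply: val_inj.
  by exists w; split=> [i im Qi|i j im jm Qi Qj]; [apply: w1|apply: w2]; rewrite ?lt.
pose bad := \bigcup_(i in [set i : 'I_l | (i < m) && Q i]) [set u in C i0 | ~~ hv (w i) u].
have badb : #|bad| <= l * b.
  apply: leq_trans (@card_exists_le _ _ [set i : 'I_l | (i < m) && Q i]
    (fun i => [set u in C i0 | ~~ hv (w i) u]) bad b _ _) _.
  - by move=> x /bigcupP[i iS xi]; exists i.
  - move=> i /[!inE] /andP[im Qi]; apply: (hb i) => //; last exact: w1.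
    by rewrite -val_eqE /= ltn_eqF.
  - by rewrite leq_mul2r -[X in _ <= X](card_ord l) max_card orbT.
have /subsetPn[x xC xb] : ~~ (C i0 \subset bad).
  by apply/negP => /subset_leq_card; rewrite leqNgt (leq_ltn_trans badb) ?hC.
have hx (i : 'I_l) : i < m -> Q i -> hv (w i) x.
  move=> im Qi; apply: contraNT xb => nh; apply/bigcupP; exists i; rewrite !inE ?im ?Qi //.
  by rewrite xC.
exists (fun i => if i == i0 then x else w i).
have lt i : (i == i0) = false -> i < m.+1 -> i < m.
  rewrite ltnS leq_eqVlt -val_eqE /= => ->; exact.
split=> [i im Qi|i j im jm Qi Qj ij].
  by case: eqP => [->//|/eqP/negPf/lt/(_ im) im']; apply: w1.
case: ifPn ij => [/eqP->|/negPf/lt/(_ im) im'] ij; case: ifPn ij => [/eqP->|/negPf/lt/(_ jm) jm'] ij.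
- by rewrite eqxx in ij.
- by rewrite hs hx.
- exact: hx.
- exact: w2.
Qed.

End Degrees.

Section Balanced.

Lemma balanced_coloring (V : finType) l : 0 < l ->
  exists c : V -> 'I_l, forall i, #|V| %/ l <= #|color_class c i|.
Proof.
move=> l0; exists (fun v => Ordinal (ltn_pmod (enum_rank v) l0)) => i.
have lt (j : 'I_(#|V| %/ l)) : j * l + i < #|V|.
  have jl : j.+1 <= #|V| %/ l := ltn_ord j.
  apply: leq_trans (leq_trunc_div #|V| l); apply: leq_trans (leq_mul jl (leqnn l)).
  by rewrite mulSn addnC ltn_add2r.
pose h j := enum_val (Ordinal (lt j)).
have hi : injective h.
  move=> j j' /enum_val_inj /(congr1 val) /= /eqP.
  by rewrite eqn_add2r eqn_pmul2r // => /eqP/val_inj.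
apply: (@leq_trans #|[set h j | j : 'I_(#|V| %/ l)]|).
  by rewrite card_imset // card_ord.
apply/subset_leq_card/subsetP => _ /imsetP[j _ ->]; rewrite inE -val_eqE /=.
by rewrite enum_valK /= modnMDl modn_small.
Qed.

End Balanced.

(** * Crossing sets and light pairs for colourings with large classes *)

Section Exactness.
Local Open Scope ring_scope.
Variable R : realType.
Variables k l : nat.
Hypotheses (k3 : (2 < k)%N) (kl : (k <= l)%N).

Let l_gt0 : (0 < l)%N. Proof. by apply: leq_trans kl; apply: leq_trans k3. Qed.
Let k_gt0 : (0 < k)%N. Proof. by apply: leq_trans k3. Qed.

Lemma expr_subS (x : R) m j : (j < m)%N -> x ^+ (m - j) = x * x ^+ (m - j.+1).
Proof. by move=> jm; rewrite -exprS subnSK. Qed.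

Lemma ler_expr (x y : R) m : 0 <= x -> x <= y -> x ^+ m <= y ^+ m.
Proof.
by move=> x0 xy; apply: lerXn2r; rewrite ?nnegrE // (le_trans x0).
Qed.

(** Bernoulli's inequality in homogeneous form. *)
Lemma expr_sub_ge (x y : R) m : 0 <= y -> y <= x ->
  x ^+ m - m%:R * y * x ^+ (m - 1) <= (x - y) ^+ m.
Proof.
move=> y0 yx; have x0 := le_trans y0 yx; elim: m => [|m IH]; first by rewrite !mul0r subr0.
rewrite subn1 /= exprS [(x - y) ^+ m.+1]exprS.
apply: (@le_trans _ _ ((x - y) * (x ^+ m - m%:R * y * x ^+ (m - 1)))); last first.
  by rewrite ler_wpM2l // subr_ge0.
case: m {IH} => [|m]; first by rewrite !expr0; lra.
rewrite subn1 /= -[m.+2%:R]natr1 [x ^+ m.+1]exprS.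
have : 0 <= m.+1%:R * (y * y) * x ^+ m by rewrite !mulr_ge0 ?exprn_ge0.
move: (x ^+ m) (m.+1%:R : R) => p q; lra.
Qed.

Lemma balanced_cross (delta : R) : 0 < delta -> exists n0 : nat,
  forall V : finType, (n0 <= #|V|)%N -> exists c : V -> 'I_l,
    (density R k l - delta) * #|V|%:R ^+ k <= #|cross c k|%:R.
Proof.
move=> delta0; pose K : R := (l ^_ k)%:R * k%:R / k`!%:R.
have [n0 hn0] := exists_nat_ge (K / delta).
exists (maxn n0 l) => V; rewrite geq_max => /andP[/hn0 hn ln].
have [c hc] := balanced_coloring V l_gt0; exists c.
have := card_cross_ge k hc; rewrite -(ler_nat R) !natrM natrX.
set n := #|V| in hn ln *; set q := (n %/ l)%N; set cr := #|cross c k|%:R.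
rewrite ler_pdivrMr // in hn => hq.
have l0 : 0 < l%:R :> R by rewrite ltr0n.
have f0 : 0 < k`!%:R :> R by rewrite ltr0n fact_gt0.
have nl1 : 1 <= n%:R / l%:R :> R by rewrite ler_pdivlMr // mul1r ler_nat.
have qn : n%:R / l%:R - 1 <= q%:R :> R.
  rewrite lerBlDr natr1 ler_pdivrMr // -natrM ler_nat ltnW //.
  by rewrite mulnC [X in (X < _)%N](divn_eq n l) mulnS addnC mulnC ltn_add2r ltn_pmod.
have := expr_sub_ge k ler01 nl1; rewrite mulr1 => h1.
have h2 : (n%:R / l%:R - 1) ^+ k <= q%:R ^+ k :> R by apply: ler_expr; rewrite ?subr_ge0.
have h3 : (n%:R / l%:R) ^+ (k - 1) <= n%:R ^+ (k - 1) :> R.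
  by apply: ler_expr; rewrite ?divr_ge0 // ler_pdivrMr // ler_peMr // ler1n.
have nk : n%:R ^+ k = n%:R * n%:R ^+ (k - 1) :> R by rewrite -exprS subn1 prednK.
rewrite -(ler_pM2l f0); apply: le_trans hq.
apply: le_trans (ler_wpM2l (ler0n _ _) (le_trans h1 h2)).
have -> : k`!%:R * ((density R k l - delta) * n%:R ^+ k) =
   (l ^_ k)%:R * (n%:R / l%:R) ^+ k - k`!%:R * delta * n%:R ^+ k.
  rewrite /density natrM natrX expr_div_n; field.
  by rewrite expf_neq0 ?gt_eqF.
rewrite mulrBr lerD2l lerN2 mulrA.
apply: (@le_trans _ _ ((l ^_ k)%:R * k%:R * n%:R ^+ (k - 1))).
  by rewrite ler_wpM2l // mulr_ge0.
rewrite nk mulrA ler_wpM2r ?exprn_ge0 //.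
by move: hn; rewrite /K ler_pdivrMr // mulrAC; lra.
Qed.

(** Half of the average class size: weak enough to survive both the stability error and the
    recolouring. *)
Definition large_classes (V : finType) (c : V -> 'I_l) :=
  forall i, #|V|%:R / (2 * l)%:R <= #|color_class c i|%:R :> R.

Lemma cross_sup_ge (V : finType) (c : V -> 'I_l) a A :
  A \in cross c a -> (a <= k)%N -> large_classes c ->
  (#|V|%:R / (2 * l)%:R) ^+ (k - a) <=
    (k - a)`!%:R * #|[set e in cross c k | A \subset e]|%:R :> R.
Proof.
move=> Aa ak hc.
case: (@arg_minnP _ (Ordinal l_gt0) xpredT (fun i => #|color_class c i|) isT) => i _ hi.
have := @card_cross_sup_ge V l c #|color_class c i| a (k - a) A Aa (fun j => hi j isT).
rewrite subnKC // -natrM => h.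
apply: (@le_trans _ _ (#|color_class c i|%:R ^+ (k - a))).
  by apply: ler_expr; rewrite ?divr_ge0.
rewrite -natrX ler_nat; apply: leq_trans h.
by rewrite leq_pmull // ffact_gt0 leq_sub2r.
Qed.

(* Every light pair in different classes lies in many missing crossing sets. *)
Lemma light_few : exists (rho : R) (n0 : nat), 0 < rho /\
  forall (V : finType) (E : {set {set V}}) (c : V -> 'I_l), uniform k E ->
  large_classes c -> (n0 <= #|V|)%N ->
  forall v t, (deg (cross c k :\: E) v)%:R <= t * #|V|%:R ^+ (k - 1) ->
  rho * #|[set u | (c u != c v) && ~~ heavy k l.+1 E v u]|%:R <= t * #|V|%:R.
Proof.
(* By [cross_sup_ge], a pair of differently coloured vertices lies in at least [r2 * n ^ (k - 2)]
   crossing sets. For large n at most half of them are edges when the pair is light. *)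
pose r2 : R := (((k - 2)`! * (2 * l) ^ (k - 2))%N%:R)^-1.
have k0 : 0 < k%:R :> R by rewrite ltr0n.
have r20 : 0 < r2.
  by rewrite invr_gt0 ltr0n muln_gt0 fact_gt0 expn_gt0 muln_gt0 l_gt0.
pose W := nvertices k l.+1.
have r22 : 0 < r2 / 2%:R by rewrite divr_gt0 ?ltr0n.
have [n0 hn0] := exists_nat_ge (W%:R / (r2 / 2%:R)).
exists (r2 / 2%:R / k%:R), n0.+1; split; first by rewrite divr_gt0.
move=> V E c Ek hc hn v t hv.
set S := [set u | _]; set n := #|V| in hn hv *.
have n_gt0 : (0 < n)%N by apply: leq_trans hn.
have n_gt0' : 0 < n%:R :> R by rewrite ltr0n.
pose y : R := n%:R ^+ (k - 2); have y0 : 0 < y by rewrite exprn_gt0.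
have nk1 : n%:R ^+ (k - 1) = n%:R * y :> R by rewrite expr_subS // ltnW.
have nk2 : y = n%:R * n%:R ^+ (k - 3) by rewrite /y expr_subS.
have hW : W%:R * n%:R ^+ (k - 3) <= r2 / 2%:R * y.
  have := hn0 n (ltnW hn); rewrite ler_pdivrMr // nk2 mulrA => h.
  by rewrite ler_wpM2r ?exprn_ge0 // mulrC.
have hcod u : u \in S -> r2 / 2%:R * y <= (cod (cross c k :\: E) v u)%:R.
  rewrite inE => /andP[cuv]; have vu : v != u by apply: contraNneq cuv => ->.
  rewrite /heavy vu -leqNgt -/W -/n => hcE.
  have vuc : [set v; u] \in cross c 2.
    apply/crossP; rewrite cards2 vu; split=> // a b /set2P[->|->] /set2P[->|->] // h.
      by rewrite h eqxx in cuv.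
    by rewrite h eqxx in cuv.
  have := cross_sup_ge vuc (ltnW k3) hc.
  set sup := #|_|; rewrite expr_div_n -/n -/y => hsup.
  have {}hsup : r2 * y <= sup%:R.
    rewrite /r2 natrM natrX invfM -mulrA mulrC ler_pdivrMr ?ltr0n ?fact_gt0 //.
    by rewrite mulrC [sup%:R * _]mulrC.
  have : (sup <= cod (cross c k :\: E) v u + cod E v u)%N.
    apply: leq_trans (leq_card_setU _ _).
    apply/subset_leq_card/subsetP => e; rewrite !inE subUset !sub1set.
    by case/andP=> -> /andP[-> ->]; case: (e \in E).
  rewrite -(ler_nat R) natrD => h1.
  have : (cod E v u)%:R <= W%:R * n%:R ^+ (k - 3) :> R.
    by rewrite -natrX -natrM ler_nat.
  by lra.
have hsum : #|S|%:R * (r2 / 2%:R * y) <= k%:R * (t * (n%:R * y)).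
  apply: (@le_trans _ _ (k * deg (cross c k :\: E) v)%N%:R); last first.
    by rewrite natrM ler_wpM2l // -nk1.
  apply: (@le_trans _ _ (\sum_(u in S) cod (cross c k :\: E) v u)%N%:R); last first.
    rewrite ler_nat; apply: sum_cod_le.
    by apply: (uniformS (subsetDl _ _)); apply: cross_uniform.
  by rewrite natr_sum mulr_natl -sumr_const; apply: ler_sum.
rewrite mulrAC ler_pdivrMr // -(ler_pM2r y0).
by move: hsum; lra.
Qed.

End Exactness.

(** * Cores built from vertices with few missing crossing sets *)

Section GreedyCores.
Local Open Scope ring_scope.
Variable R : realType.
Variables k l : nat.
Hypotheses (k3 : (2 < k)%N) (kl : (k <= l)%N).

Let l_gt0 : (0 < l)%N. Proof. by apply: leq_trans kl; apply: leq_trans k3. Qed.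

Definition bad_vertices (V : finType) (E : {set {set V}}) (c : V -> 'I_l) (t : R) :=
  [set v | t * #|V|%:R ^+ (k - 1) < (deg (cross c k :\: E) v)%:R].

Lemma leq_trunc (x : R) m : m%:R <= x -> (m <= Num.trunc x)%N.
Proof.
by move=> mx; rewrite truncn_ge_nat // (le_trans _ mx).
Qed.

Lemma trunc_ler (x : R) : 0 <= x -> (Num.trunc x)%:R <= x.
Proof. by move=> x0; rewrite -truncn_ge_nat. Qed.

(** Pairwise heavy vertices from the l - 1 other classes, heavy to both u and v and outside e, form
    a core together with u and v. The pair (u, v) itself may be light, but the edge e serves it. *)
Lemma good_pair_not_covered : exists (t : R) (n0 : nat), 0 < t /\
  forall (V : finType) (E : {set {set V}}) (c : V -> 'I_l), uniform k E ->
  ~~ contains (Hypergraph E) (expanded_clique k l.+1) ->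
  large_classes R c -> (n0 <= #|V|)%N ->
  #|bad_vertices E c t|%:R <= #|V|%:R / (8 * l)%:R :> R ->
  forall e u v, e \in E -> u \in e -> v \in e -> u != v -> c u = c v ->
  u \notin bad_vertices E c t -> v \notin bad_vertices E c t -> False.
Proof.
have [rho [n0 [rho0 hrho]]] := light_few R k3 kl.
have l0 : 0 < l%:R :> R by rewrite ltr0n.
have l20 : 0 < l%:R + 2 :> R by rewrite addr_gt0.
(* In units of n/(8l): a class has size at least 4, the bad vertices take 1, the edge e less than 2,
   and the two light neighbourhoods with the l greedy exclusions take [(l + 2) * b0], which is 1. *)
pose b0 : R := (8 * l%:R * (l%:R + 2))^-1.
have b00 : 0 < b0 by rewrite invr_gt0 !mulr_gt0.
exists (b0 * rho), (maxn n0 (4 * l * k).+1); split; first by rewrite mulr_gt0.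
move=> V E c Ek Ef hc; rewrite geq_max => /andP[hn0 hn]; set bad := bad_vertices _ _ _.
set n := #|V| in hn0 hn *.
have hb0 : (l%:R + 2) * (b0 * n%:R) = n%:R / (8 * l%:R).
  by rewrite /b0; field; rewrite ?(gt_eqF l0) ?(gt_eqF l20).
have n0' : 0 <= b0 * n%:R by rewrite mulr_ge0 // ltW.
move=> hbad e u v eE ue ve uv cuv ub vb.
pose light x := [set y | (c y != c x) && ~~ heavy k l.+1 E x y].
have hlight x : x \notin bad -> #|light x|%:R <= b0 * n%:R.
  rewrite inE -leNgt -/n => /(hrho V E c Ek hc hn0 x).
  by rewrite mulrAC [_ * n%:R * rho]mulrC ler_pM2l.
pose b := Num.trunc (b0 * n%:R).
pose Z := bad :|: (light u :|: (light v :|: e)).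
pose C i := color_class c i :\: Z.
have notlight x y : c x != c y -> y \notin light x -> heavy k l.+1 E x y.
  by move=> xy; rewrite inE eq_sym xy negbK.
have [||w [w1 w2]] := @select_core V (heavy k l.+1 E) l (fun i => i != c u) C b u (@heavy_sym V k l.+1 E).
- move=> i j x _ _ ij /setDP[]; rewrite inE => /eqP xi; rewrite !in_setU !negb_or => /andP[xb _].
  apply: leq_trans (leq_trunc (hlight x xb)).
  apply/subset_leq_card/subsetP => y; rewrite !inE xi => /andP[/andP[_ /eqP->] ->].
  by rewrite eq_sym ij.
- move=> i _; rewrite -(ltr_nat R).
  have h1 : (#|color_class c i| <= #|C i| + #|bad| + #|light u| + #|light v| + k)%N.
    rewrite -(cardsID Z) addnC -!addnA leq_add2l.
    apply: (@leq_trans #|Z|); first by rewrite subset_leq_card ?subsetIr.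
    apply: leq_trans (leq_card_setU _ _) _; rewrite leq_add2l.
    apply: leq_trans (leq_card_setU _ _) _; rewrite leq_add2l.
    apply: leq_trans (leq_card_setU _ _) _; rewrite leq_add2l.
    by rewrite (uniformP _ _ Ek).
  move: h1; rewrite -(ler_nat R) !natrD => h1.
  have := hc i; have := hlight u ub; have := hlight v vb.
  have : (l * b)%N%:R <= l%:R * (b0 * n%:R) by rewrite natrM ler_wpM2l // trunc_ler.
  have : k%:R < n%:R / (4 * l%:R) :> R.
    by rewrite ltr_pdivlMr ?mulr_gt0 // -!natrM ltr_nat mulnC.
  move: hbad hb0; rewrite -/n !natrM.
  have -> : n%:R / (2 * l%:R) = 4 * (n%:R / (8 * l%:R)) :> R by field; rewrite gt_eqF.
  have -> : n%:R / (4 * l%:R) = 2 * (n%:R / (8 * l%:R)) :> R by field; rewrite gt_eqF.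
  move: (n%:R / (8 * l%:R)) (b0 * n%:R) => p q; lra.
have wc i : i != c u -> c (w i) = i /\ w i \notin Z.
  by move=> /w1 /setDP[]; rewrite inE => /eqP.
pose w' i := if i == c u then u else w i.
have w'u : w' (c u) = u by rewrite /w' eqxx.
have w'n i : i != c u -> w' i = w i by rewrite /w' => /negPf->.
have w'c i : c (w' i) = i.
  by case: (eqVneq i (c u)) => [->|ni]; rewrite ?w'u // w'n //; case: (wc i ni).
have hvw x i : x \in [set u; v] -> i != c u -> heavy k l.+1 E x (w i).
  move=> xuv ni; have [wi] := wc i ni; rewrite !in_setU !negb_or => /and4P[_ lu lv _].
  case/set2P: xuv => ->; apply: notlight => //; rewrite wi -?cuv eq_sym //.
case/negP: Ef; apply: (@heavy_core_contains V k l E v w' Ek).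
- move=> i; case: (eqVneq i (c u)) => [->|ni]; first by rewrite w'u eq_sym.
  rewrite w'n //; have [_] := wc i ni; rewrite !in_setU !negb_or => /and4P[_ _ _ we].
  by apply: contraNneq we => <-.
- by move=> i j /(congr1 c); rewrite !w'c.
- move=> i j ij; case: (eqVneq i (c u)) ij => [->|ni]; case: (eqVneq j (c u)) => [->|nj] ij.
  + by [].
  + by rewrite w'u w'n // hvw ?set21.
  + by rewrite w'u w'n // heavy_sym hvw ?set21.
  + by rewrite !w'n // w2.
- right; exists (c u), e; rewrite w'u; split=> // i ni; rewrite w'n //.
    by have [_] := wc i ni; rewrite !in_setU !negb_or => /and4P[].
  by rewrite hvw ?set22.
Qed.

(** Otherwise every class contains many good heavy neighbours of z, and [select_core] picks pairwise
    heavy ones; with z they form a core of l + 1 vertices. *)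
Lemma few_heavy_neighbours (eps : R) : 0 < eps -> exists (t : R) (n0 : nat), 0 < t /\
  forall (V : finType) (E : {set {set V}}) (c : V -> 'I_l), uniform k E ->
  ~~ contains (Hypergraph E) (expanded_clique k l.+1) ->
  large_classes R c -> (n0 <= #|V|)%N ->
  #|bad_vertices E c t|%:R <= eps / 4 * #|V|%:R ->
  forall z, exists i, #|[set v in color_class c i | heavy k l.+1 E z v]|%:R <= eps * #|V|%:R.
Proof.
move=> eps0; have [rho [n0 [rho0 hrho]]] := light_few R k3 kl.
have l0 : 0 < l%:R :> R by rewrite ltr0n.
pose b0 : R := eps / (4 * l%:R).
have b00 : 0 < b0 by rewrite divr_gt0 ?mulr_gt0.
exists (b0 * rho), n0; split; first by rewrite mulr_gt0.
move=> V E c Ek Ef hc hn0; set bad := bad_vertices _ _ _ => hbad z.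
set n := #|V| in hn0 hbad *.
have n_gt0 : 0 < n%:R :> R by rewrite ltr0n; apply/card_gt0P; exists z.
have hb0 : l%:R * (b0 * n%:R) = eps / 4 * n%:R.
  by rewrite /b0; field; rewrite gt_eqF.
have n0' : 0 <= b0 * n%:R by rewrite mulr_ge0 // ltW.
apply/existsP; apply: contraNT Ef => /existsPn hi.
pose light x := [set y | (c y != c x) && ~~ heavy k l.+1 E x y].
have hlight x : x \notin bad -> #|light x|%:R <= b0 * n%:R.
  rewrite inE -leNgt -/n => /(hrho V E c Ek hc hn0 x).
  by rewrite mulrAC [_ * n%:R * rho]mulrC ler_pM2l.
pose b := Num.trunc (b0 * n%:R).
pose N i := [set v in color_class c i | heavy k l.+1 E z v].
pose C i := N i :\: bad.
have [||w [w1 w2]] := @select_core V (heavy k l.+1 E) l xpredT C b z (@heavy_sym V k l.+1 E).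
- move=> i j x _ _ ij /setDP[/setIdP[]]; rewrite inE => /eqP xi _ xb.
  apply: leq_trans (leq_trunc (hlight x xb)).
  apply/subset_leq_card/subsetP => y; rewrite !inE xi.
  by move=> /andP[/andP[_ /andP[/eqP-> _]] ->]; rewrite eq_sym ij.
- move=> i _; rewrite -(ltr_nat R).
  have h1 : (#|N i| <= #|C i| + #|bad|)%N.
    rewrite -(cardsID bad) addnC leq_add2l.
    by rewrite subset_leq_card ?subsetIr.
  move: h1; rewrite -(ler_nat R) natrD => h1.
  have := hi i; rewrite -ltNge -/(N i).
  have : (l * b)%N%:R <= l%:R * (b0 * n%:R) by rewrite natrM ler_wpM2l // trunc_ler.
  rewrite hb0; have : 0 < eps * n%:R by rewrite mulr_gt0.
  by move: hbad h1; lra.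
have wN i : w i \in N i by have /setDP[] := w1 i isT.
have wc i : c (w i) = i by have /setIdP[] := wN i; rewrite inE => /eqP.
have wz i : heavy k l.+1 E z (w i) by have /setIdP[] := wN i.
apply: (@heavy_core_contains V k l E z w Ek).
- by move=> i; apply: contraTneq (wz i) => <-; rewrite heavy_irr.
- by move=> i j /(congr1 c); rewrite !wc.
- by move=> i j ij; apply: w2.
- by left.
Qed.

End GreedyCores.

(** * Effect of recolouring on degrees *)

Section Recoloring.
Variables (V : finType) (k l : nat) (E : {set {set V}}).
Hypothesis Ek : uniform k E.

(** A set that is crossing only after the recolouring contains a recoloured vertex, and v with such
    a vertex lies in at most n^(k-2) sets. *)
Lemma deg_recolor (c c' : V -> 'I_l) (B : {set V}) v :
  (forall u, u \notin B -> c' u = c u) -> v \notin B ->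
  deg (cross c' k :\: E) v <= deg (cross c k :\: E) v + #|B| * #|V| ^ (k - 2).
Proof.
move=> cc vB; pose F u := [set e in cross c' k | (u \in e) && (v \in e)].
apply: (@leq_trans #|[set e in cross c k :\: E | v \in e] :|: \bigcup_(u in B) F u|).
  apply/subset_leq_card/subsetP => e; rewrite in_setU !in_set.
  rewrite -[(_ == k) && _]/(_ && _) => /andP[/andP[eE ec] ve].
  have ec' : e \in cross c' k by rewrite inE.
  case: (boolP [disjoint e & B]) => eB; last first.
    case/pred0Pn: eB => u /andP[/= ue uB]; apply/orP; right; apply/bigcupP.
    by exists u; rewrite // inE ec' ue.
  rewrite ve eE -[(_ == k) && _]/(_ && _) andbT /=; apply/orP; left.
  have {ec'} /crossP[ek ei] := ec'.
  have eB' x : x \in e -> x \notin B by move=> xe; rewrite (disjointFr eB).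
  suff : e \in cross c k by rewrite inE.
  by apply/crossP; split=> // x y xe ye; rewrite -!cc ?eB'// => /ei; apply.
apply: leq_trans (leq_card_setU _ _) _; rewrite leq_add2l.
apply: (@card_exists_le _ _ _ F) => [e /bigcupP[u uB ue]|u uB]; first by exists u.
apply: cod_le; first exact: cross_uniform.
by apply: contraNneq vB => <-.
Qed.

Lemma inner_deg_bound u (X : {set V}) (P : pred V) :
  (forall v, P v -> v != u -> v \notin X -> ~~ heavy k l.+1 E u v) ->
  #|[set e in E | (u \in e) && [exists v in e, (v != u) && P v]]| <=
  #|X| * #|V| ^ (k - 2) + #|V| * (nvertices k l.+1 * #|V| ^ (k - 3)).
Proof.
move=> hX; pose F v := [set e in E | (u \in e) && (v \in e)].
apply: (@leq_trans #|\bigcup_(v in X :\ u) F v :|: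
   \bigcup_(v in [set v | (v != u) && ~~ heavy k l.+1 E u v]) F v|).
  apply/subset_leq_card/subsetP => e; rewrite inE.
  move=> /and3P[eE ue /exists_inP[v ve /andP[vu Pv]]].
  have eF : e \in F v by rewrite inE eE ue.
  rewrite inE; case: (boolP (v \in X)) => vX; apply/orP; [left|right].
    by apply/bigcupP; exists v; rewrite // !inE vu.
  by apply/bigcupP; exists v; rewrite // inE vu hX.
apply: leq_trans (leq_card_setU _ _) _; rewrite leq_add //.
  apply: (@leq_trans (#|X :\ u| * #|V| ^ (k - 2))).
    apply: (@card_exists_le _ _ _ F) => [e /bigcupP[v uB ue]|v]; first by exists v.
    by rewrite !inE => /andP[vu _]; apply: cod_le; rewrite // eq_sym.
  by rewrite leq_mul2r subset_leq_card ?orbT // subsetDl.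
apply: (@leq_trans (#|[set v | (v != u) && ~~ heavy k l.+1 E u v]| *
    (nvertices k l.+1 * #|V| ^ (k - 3)))).
  apply: (@card_exists_le _ _ _ F) => [e /bigcupP[v uB ue]|v]; first by exists v.
  by rewrite inE /heavy eq_sym => /andP[-> /=]; rewrite -leqNgt.
by rewrite leq_mul2r max_card orbT.
Qed.

End Recoloring.

(** * Complete l-partite hypergraphs are extremal *)

Section ExactBound.
Local Open Scope ring_scope.
Variable R : realType.
Variables k l : nat.
Hypotheses (k3 : (2 < k)%N) (kl : (k <= l)%N).

Let l_gt0 : (0 < l)%N. Proof. by apply: leq_trans kl; apply: leq_trans k3. Qed.

(* Starting from a stable colouring c, recolour every bad vertex by a class in
   which it has few heavy neighbours.  A vertex v that is still bad afterwards
   lies in fewer non-crossing edges than missing crossing sets, and every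
   non-crossing edge contains such a vertex. *)
Lemma exact_bound : exists n0 : nat, forall (V : finType) (E : {set {set V}}),
  (n0 <= #|V|)%N -> uniform k E ->
  ~~ contains (Hypergraph E) (expanded_clique k l.+1) ->
  exists c : V -> 'I_l, (#|E| <= #|cross c k|)%N.
Proof.
have l0 : 0 < l%:R :> R by rewrite ltr0n.
have k0 : 0 < k%:R :> R by rewrite ltr0n; apply: leq_trans k3.
have l80 : 0 < (8 * l%:R)^-1 :> R by rewrite invr_gt0 mulr_gt0.
have [tA [nA [tA0 hA]]] := good_pair_not_covered R k3 kl.
(* A remaining bad vertex will lie in at most [3 * e4 * n ^ (k - 1)] non-crossing edges. Its missing
   degree exceeds [tA * n ^ (k - 1)]; as each missing set has k vertices, this amounts to
   [4 * e4 * n ^ (k - 1)] missing sets per bad vertex, which wins. *)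
pose e4 : R := tA / (4 * k%:R).
have e40 : 0 < e4 by rewrite divr_gt0 ?mulr_gt0.
have e4A : tA = 4 * e4 * k%:R by rewrite /e4; field; rewrite gt_eqF.
clearbody e4.
have [tB [nB [tB0 hB]]] := few_heavy_neighbours k3 kl e40.
have [e1 [e10 e1B e1A]] : exists e1 : R, [/\ 0 < e1, e1 <= tB & e1 <= tA / 2].
  have tA2 : 0 < tA / 2 by rewrite divr_gt0.
  by exists (Num.min tB (tA / 2)); rewrite lt_min !ge_min !lexx tB0 tA2 orbT.
have [e2 [e20 e24 e2A e2l]] : exists e2 : R,
    [/\ 0 < e2, e2 <= e4 / 4, e2 <= tA / 2 & e2 <= (8 * l%:R)^-1].
  exists (Num.min (e4 / 4) (Num.min (tA / 2) (8 * l%:R)^-1)).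
  have tA2 : 0 < tA / 2 by rewrite divr_gt0.
  have e44 : 0 < e4 / 4 by rewrite divr_gt0.
  by rewrite !lt_min !ge_min !lexx tA2 e44 l80 !orbT.
have [e [e0 e12 el]] : exists e : R,
    [/\ 0 < e, e * k%:R <= e1 * e2 & e <= 2 * (8 * l%:R)^-1].
  exists (Num.min (e1 * e2 / k%:R) (2 * (8 * l%:R)^-1)).
  have e12k : 0 < e1 * e2 / k%:R by rewrite divr_gt0 ?mulr_gt0.
  have l82 : 0 < 2 * (8 * l%:R)^-1 :> R by rewrite mulr_gt0.
  by rewrite lt_min -ler_pdivlMr // !ge_min !lexx e12k l82 orbT.
have [delta [nS [delta0 hS]]] := stability k3 kl e0.
have [nb hb] := balanced_cross k3 kl delta0.
pose W := nvertices k l.+1.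
have [nW hW] := exists_nat_ge (W%:R / e4).
exists (maxn (maxn nA nB) (maxn nS (maxn nb nW.+1))) => V E.
rewrite !geq_max => /andP[/andP[hnA hnB] /and3P[hnS hnb hnW]] Ek Ef.
set n := #|V| in hnA hnB hnS hnb hnW.
have n_gt0 : (0 < n)%N by apply: leq_trans hnW.
have n0R : 0 < n%:R :> R by rewrite ltr0n.
(* Below the range of stability, a balanced colouring already has enough crossing sets. *)
have [hE|hE] := ltP (#|E|%:R) ((density R k l - delta) * n%:R ^+ k).
  have [c hc] := hb V hnb; exists c.
  by rewrite -(ler_nat R); apply: le_trans (ltW hE) hc.
have [c [cD cS]] := hS V E Ek Ef hnS hE; rewrite -/n in cD cS.
have nl : n%:R / (2 * l)%:R = 4 * ((8 * l%:R)^-1 * n%:R) :> R.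
  by rewrite natrM; field; rewrite gt_eqF.
have nl' : n%:R / l%:R = 8 * ((8 * l%:R)^-1 * n%:R) :> R.
  by field; rewrite gt_eqF.
have hc6 i : 6 * ((8 * l%:R)^-1 * n%:R) <= #|color_class c i|%:R :> R.
  have := cS i; rewrite ler_norml => /andP[+ _].
  have := ler_wpM2r (ltW n0R) el; rewrite nl'; lra.
have nl0 : 0 < (8 * l%:R)^-1 * n%:R :> R by rewrite mulr_gt0.
have hc : large_classes R c by move=> i; have := hc6 i; rewrite -/n nl; lra.
pose B0 := bad_vertices k E c e1.
have nk : n%:R ^+ k = n%:R * n%:R ^+ (k - 1) :> R by rewrite -[in LHS](subn0 k) expr_subS // ltnW // ltnW.
have nk1 : n%:R ^+ (k - 1) = n%:R * n%:R ^+ (k - 2) :> R.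
  by rewrite expr_subS // ltnW.
have nk2 : n%:R ^+ (k - 2) = n%:R * n%:R ^+ (k - 3) :> R.
  by rewrite expr_subS.
have y0 : 0 < n%:R ^+ (k - 1) :> R by rewrite exprn_gt0.
have z0 : 0 < n%:R ^+ (k - 2) :> R by rewrite exprn_gt0.
have crossD (c0 : V -> 'I_l) : uniform k (cross c0 k :\: E).
  exact: uniformS (subsetDl _ _) (cross_uniform _ _).
have hB0 : #|B0|%:R <= e2 * n%:R :> R.
  rewrite -(ler_pM2r (mulr_gt0 e10 y0)); apply: le_trans (card_deg_gt _ (crossD c)) _.
  apply: (@le_trans _ _ (e * n%:R ^+ k * k%:R)); first by rewrite ler_wpM2r.
  have := ler_wpM2r (ltW (mulr_gt0 n0R y0)) e12; rewrite nk; lra.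
pose N z i := [set v in color_class c i | heavy k l.+1 E z v].
have hBB : #|bad_vertices k E c tB|%:R <= e4 / 4 * #|V|%:R :> R.
  apply: (@le_trans _ _ (#|B0|%:R)).
    rewrite ler_nat; apply/subset_leq_card/subsetP => v; rewrite !inE.
    by apply: le_lt_trans; rewrite ler_wpM2r // ltW.
  by apply: le_trans hB0 _; rewrite ler_wpM2r.
have hN z : exists i, #|N z i|%:R <= e4 * n%:R by apply: hB.
pose c' v := if v \in B0 then xchoose (hN v) else c v.
have c'E u : u \notin B0 -> c' u = c u by rewrite /c' => /negPf->.
have hc' : large_classes R c'.
  move=> i; rewrite -/n nl; have : (#|color_class c i| <= #|color_class c' i| + #|B0|)%N.
    rewrite -(cardsID B0) addnC leq_add //; last by rewrite subset_leq_card ?subsetIr.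
    apply/subset_leq_card/subsetP => v; rewrite inE => /andP[vB].
    by rewrite !in_set c'E.
  rewrite -(ler_nat R) natrD; have := hc6 i; have := ler_wpM2r (ltW n0R) e2l.
  by move: hB0; lra.
pose B := bad_vertices k E c' tA.
(* Only vertices of B0 change colour, so elsewhere the missing degree rises by at most
   [|B0| * n ^ (k - 2)]; the gap between the thresholds [e1] and [tA] absorbs this. *)
have BB0 : B \subset B0.
  apply/subsetP => v; apply: contraTT => vB0; rewrite inE -leNgt -/n.
  have := deg_recolor k E c'E vB0; rewrite -(ler_nat R) natrD natrM natrX -/n.
  move: (vB0); rewrite inE -leNgt -/n => h1 /le_trans; apply.
  have := ler_wpM2r (ltW z0) hB0; have := ler_wpM2r (ltW y0) e1A.
  have := ler_wpM2r (ltW y0) e2A; rewrite nk1 in h1 *; lra.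
have hBA : #|B|%:R <= n%:R / (8 * l)%:R :> R.
  apply: (@le_trans _ _ (#|B0|%:R)); first by rewrite ler_nat subset_leq_card.
  by apply: le_trans hB0 _; rewrite mulrC natrM ler_wpM2l.
exists c'.
pose F u := [set e in E | (u \in e) && [exists v in e, (v != u) && (c' v == c' u)]].
have hF u : u \in B -> #|F u|%:R <= 3 * e4 * n%:R ^+ (k - 1) :> R.
  move=> uB; have uB0 := subsetP BB0 u uB.
  have := @inner_deg_bound V k l E Ek u (B0 :|: N u (c' u)) (fun v => c' v == c' u).
  rewrite -/(F u) => h; have {}h := h _; move: h; rewrite -/n -/W -(ler_nat R).
  move=> /(_ _)/le_trans; apply.
    move=> v /eqP cv vu; rewrite !inE !negb_or => /andP[vB0].
    rewrite -(c'E v) ?cv; last by rewrite inE.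
    by rewrite eqxx.
  rewrite natrD !natrM !natrX.
  have hNu : #|N u (c' u)|%:R <= e4 * n%:R :> R.
    by rewrite /c' uB0; apply: (xchooseP (hN u)).
  have : #|B0 :|: N u (c' u)|%:R <= e4 / 4 * n%:R + e4 * n%:R :> R.
    apply: (@le_trans _ _ (#|B0|%:R + #|N u (c' u)|%:R)).
      by rewrite -natrD ler_nat leq_card_setU.
    by rewrite lerD // (le_trans hB0) // ler_wpM2r.
  move=> /(ler_wpM2r (ltW z0)).
  have := hW n (ltnW hnW); rewrite ler_pdivrMr // => /(ler_wpM2r (ltW z0)).
  have : 0 < e4 * (n%:R * n%:R ^+ (k - 2)) by rewrite !mulr_gt0.
  have -> : n%:R * (W%:R * n%:R ^+ (k - 3)) = W%:R * n%:R ^+ (k - 2) :> R.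
    by rewrite nk2; ring.
  rewrite nk1; move: (#|B0 :|: _|%:R : R) => x; lra.
have hnon : #|E :\: cross c' k|%:R <= #|B|%:R * (3 * e4 * n%:R ^+ (k - 1)) :> R.
  set b := 3 * e4 * _; have b_ge0 : 0 <= b by rewrite !mulr_ge0 // ltW.
  apply: (@le_trans _ _ (#|B| * Num.trunc b)%N%:R); last first.
    by rewrite natrM ler_wpM2l // trunc_ler.
  rewrite ler_nat; apply: (@card_exists_le _ _ B F) => [e' |u uB]; last first.
    by apply/leq_trunc/hF.
  rewrite !inE => /andP[+ eE]; rewrite (uniformP _ _ Ek _ eE) eqxx /=.
  move=> /forall_inPn[u ue /forall_inPn[v ve]].
  rewrite negb_imply negbK => /andP[uv /eqP cuv].
  have : (u \in B) || (v \in B).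
    rewrite -[_ || _]negbK negb_or; apply/negP => /andP[uB vB].
    exact: (hA V E c' Ek Ef hc' hnA hBA e' u v).
  case/orP=> xB; [exists u|exists v] => //; rewrite inE eE.
    by rewrite ue; apply/exists_inP; exists v; rewrite // eq_sym uv cuv eqxx.
  by rewrite ve; apply/exists_inP; exists u; rewrite // uv cuv eqxx.
have hD : #|B|%:R * (4 * e4 * n%:R ^+ (k - 1)) <= #|cross c' k :\: E|%:R :> R.
  have tE : tA * n%:R ^+ (k - 1) = 4 * e4 * n%:R ^+ (k - 1) * k%:R by rewrite e4A mulrAC.
  have := card_deg_gt (tA * n%:R ^+ (k - 1)) (crossD c').
  by rewrite -[[set v | _]]/B tE mulrA ler_pM2r.
have hM : (#|cross c' k :\: E| + #|E| = #|cross c' k| + #|E :\: cross c' k|)%N.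
  by rewrite -(cardsID E (cross c' k)) -(cardsID (cross c' k) E) setIC; ring.
rewrite -(ler_nat R); move/(congr1 (fun m => m%:R : R)): hM; rewrite /= !natrD.
have : #|B|%:R * (3 * e4 * n%:R ^+ (k - 1)) <= #|B|%:R * (4 * e4 * n%:R ^+ (k - 1)) :> R.
  have e434 : 3 * e4 <= 4 * e4 by lra.
  by apply: ler_wpM2l => //; apply: ler_wpM2r => //; apply: ltW.
by lra.
Qed.

End ExactBound.

(** * Increments of the extremal function *)

Section Extremal.

(** Since F has no isolated vertices, a copy of it stays within the image of [h]; adding isolated
    vertices to a hypergraph creates no copy. *)
Lemma covered_contains (V1 V2 : finType) (h : V1 -> V2) (E : {set {set V1}}) (F : hypergraph) :
  injective h -> (forall x, exists2 e, e \in edges F & x \in e) ->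
  contains (Hypergraph [set h @: (e : {set V1}) | e in E]) F -> contains (Hypergraph E) F.
Proof.
move=> hi Fc /existsP[f /andP[/injectiveP fi /forall_inP fE]].
have fh x : exists y, h y == f x.
  have [e /fE /imsetP[e' _ fe] xe] := Fc x.
  have : f x \in f @: e by apply: imset_f.
  by rewrite fe => /imsetP[y _ ->]; exists y.
pose f' x := xchoose (fh x); have f'E x : h (f' x) = f x by apply/eqP/(xchooseP (fh x)).
apply/existsP; exists (finfun f'); apply/andP; split.
  by apply/injectiveP => x y; rewrite !ffunE => /(congr1 h); rewrite !f'E => /fi.
apply/forall_inP => e eF; have /imsetP[e' e'E fe] := fE e eF.
rewrite (_ : _ @: e = e') //=; apply: (imset_inj hi); rewrite -fe -imset_comp.
by apply: eq_imset => x; rewrite /= ffunE f'E.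
Qed.

Lemma expanded_clique_covered k l x : 0 < l ->
  exists2 e, e \in edges (expanded_clique k l.+1) & x \in e.
Proof.
move=> l0; case: x => [i|[e j]].
  have [j ij] : exists j, i != j.
    have /card_gt1P[a [b [_ _ ab]]] : 1 < #|'I_l.+1| by rewrite card_ord.
    by case: (eqVneq i a) => [->|ia]; [exists b|exists a].
  have c2 : #|[set i; j]| == 2 by rewrite cards2 ij.
  pose e0 : clique_edge l.+1 := exist _ [set i; j] c2.
  exists ((inl @: val e0) :|: [set inr (e0, t) | t : 'I_(k - 2)]); first exact: imset_f.
  by rewrite inE imset_f // set21.
exists ((inl @: val e) :|: [set inr (e, t) | t : 'I_(k - 2)]); first exact: imset_f.
by rewrite inE imset_f ?orbT.
Qed.

Lemma matching_covered k m x : exists2 e, e \in edges (matching k m) & x \in e.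
Proof.
case: x => i j; exists [set (i, j') | j' : 'I_k]; first exact: imset_f.
exact: imset_f.
Qed.

(** The first alternative covers the default value of an empty maximum. *)
Lemma exk_witness k m Fs : exk k m Fs = 0 \/
  exists E : {set {set 'I_m}},
    [/\ uniform k E, is_free Fs (Hypergraph E) & #|E| = exk k m Fs].
Proof.
pose P (E : {set {set 'I_m}}) :=
  k_uniform k (Hypergraph E) && is_free Fs (Hypergraph E).
rewrite /exk -/P.
case: (pickP P) => [E0 PE0|P0]; last by left; rewrite big_pred0.
have [|E PE ->] := @eq_bigmax_cond _ [pred E | P E] (fun E => #|pred_of_set E|).
  by apply/card_gt0P; exists E0.
by right; exists E; move: PE; rewrite inE => /andP[].
Qed.

(** An extremal hypergraph on ks + k - 1 vertices, padded with isolated vertices, is one vertex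
    short of room for s + 1 disjoint edges. *)
Lemma exk_matching_ge k l n s : 0 < l -> k * s + k - 1 <= n -> 0 < k ->
  exk k (k * s + k - 1) [:: expanded_clique k l.+1] <=
  exk k n [:: expanded_clique k l.+1; matching k s.+1].
Proof.
move=> l0 Nn k0.
have [->//|[E [Ek /=]]] := exk_witness k (k * s + k - 1) [:: expanded_clique k l.+1].
rewrite andbT => Ef <-.
have hi : injective (widen_ord Nn) by move=> x y /(congr1 val) /= /val_inj.
have -> : #|E| = #|[set widen_ord Nn @: (e : {set _}) | e in E]|.
  by rewrite card_imset //; apply: imset_inj.
have := @leq_exk k [:: expanded_clique k l.+1; matching k s.+1]
  (Hypergraph [set widen_ord Nn @: (e : {set _}) | e in E]).
rewrite /= card_ord; apply.
  apply/forall_inP => _ /imsetP[e eE ->]; rewrite card_imset //.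
  by apply/eqP/(uniformP _ _ Ek).
rewrite andbT; apply/andP; split.
  by apply: contra Ef; apply: covered_contains => // x; apply: expanded_clique_covered.
apply/negP => /(covered_contains hi (@matching_covered k s.+1)).
case/existsP => f /andP[/injectiveP/leq_card + _].
rewrite /= card_prod !card_ord; apply/negP; rewrite -ltnNge mulSn mulnC.
by rewrite -[X in _ < X]prednK ?addn_gt0 ?k0 // ltnS -subn1 addnC leq_sub2r // addnC.
Qed.

Lemma exk_induced (V : finType) k l (E : {set {set V}}) (U : {set V}) :
  uniform k E -> ~~ contains (Hypergraph E) (expanded_clique k l.+1) ->
  #|[set e in E | e \subset U]| <= exk k #|U| [:: expanded_clique k l.+1].
Proof.
move=> Ek Ef; pose T : finType := {x | x \in U}; pose vl : T -> V := val.
have vli : injective vl by apply: val_inj.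
pose E' := [set e : {set T} | vl @: e \in E].
have -> : #|[set e in E | e \subset U]| = #|E'|.
  rewrite -(card_imset (mem E') (imset_inj vli)); apply: eq_card => e.
  rewrite inE; apply/andP/imsetP => [[eE eU]|[e' + ->]].
    have ee : e = vl @: [set x : T | vl x \in e].
      apply/setP => x; apply/idP/imsetP => [xe|[y + ->]]; last by rewrite inE.
      by exists (exist _ x (subsetP eU x xe) : T); rewrite ?inE.
    by exists [set x : T | vl x \in e]; rewrite // inE -ee.
  rewrite inE => ?; split=> //; apply/subsetP => _ /imsetP[x _ ->]; exact: valP.
have := @leq_exk k [:: expanded_clique k l.+1] (Hypergraph E').
rewrite /= card_sig; apply.
  apply/forall_inP => e; rewrite inE => /(uniformP _ _ Ek) <-.
  by rewrite card_imset.
rewrite andbT; apply: contra Ef; apply: contains_trans.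
apply/existsP; exists (finfun vl); apply/andP; split.
  by apply/injectiveP => x y; rewrite !ffunE => /vli.
apply/forall_inP => e; rewrite inE => eE; rewrite (_ : _ @: e = vl @: e) //.
by apply: eq_imset => x; rewrite ffunE.
Qed.

Lemma exk_ge_cross (V : finType) k l (c : V -> 'I_l) :
  #|cross c k| <= exk k #|V| [:: expanded_clique k l.+1].
Proof.
have := @leq_exk k [:: expanded_clique k l.+1] (Hypergraph (cross c k)); apply.
  exact: cross_uniform.
by rewrite /= andbT; apply: cross_free (subxx _).
Qed.

(** The vertex [None] gets the colour of v; replacing v by it maps crossing sets through v to new
    crossing sets. *)
Lemma cross_clone (V : finType) k l (c : V -> 'I_l) v : 0 < k ->
  exists c' : option V -> 'I_l, #|cross c k| + deg (cross c k) v <= #|cross c' k|.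
Proof.
move=> k0; pose c' x := if x is Some u then c u else c v; exists c'.
pose A := [set Some @: (e : {set V}) | e in cross c k].
pose B := [set None |: Some @: (e :\ v) | e in [set e in cross c k | v \in e]].
have Si : injective (@Some V) by move=> x y [].
have NS (S : {set V}) : None \notin Some @: S by apply/negP => /imsetP[].
have cA : #|A| = #|cross c k| by rewrite card_imset //; apply: imset_inj.
have cB : #|B| = deg (cross c k) v.
  rewrite card_in_imset // => e f /[!inE] /andP[_ ve] /andP[_ vf] /(congr1 (fun S => S :\ None)).
  by rewrite !setU1K // => /(imset_inj Si) ef; rewrite -(setD1K ve) ef setD1K.
have dAB : A :&: B = set0.
  apply/setP => S; rewrite !inE; apply/negP => /andP[/imsetP[e _ ->] /imsetP[f _ ef]].
  by have := NS e; rewrite ef setU11.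
rewrite -cA -cB -[_ + _]subn0 -(cards0 (set_of (option V))) -dAB -cardsU.
apply/subset_leq_card; rewrite subUset; apply/andP; split; apply/subsetP => S /imsetP[e].
  move=> /crossP[ek ec] ->; apply/crossP; rewrite card_imset //; split=> //.
  by move=> _ _ /imsetP[x xe ->] /imsetP[y ye ->] /= /ec ->.
rewrite inE => /andP[/crossP[ek ec] ve] ->; apply/crossP.
split; first by rewrite cardsU1 NS card_imset // -ek (cardsD1 v e) ve.
move=> _ _ /setU1P[->|/imsetP[x /setD1P[xv xe] ->]] /setU1P[->|/imsetP[y /setD1P[yv ye] ->]] //=.
- by move=> /(ec _ _ ve ye) vy; rewrite vy eqxx in yv.
- by move=> /(ec _ _ xe ve) vx; rewrite vx eqxx in xv.
- by move=> /ec ->.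
Qed.

Local Open Scope ring_scope.
Variable R : realType.
Variables k l : nat.
Hypotheses (k3 : (2 < k)%N) (kl : (k <= l)%N).

Lemma exk_ge_density (delta : R) : 0 < delta -> exists n0 : nat, forall m, (n0 <= m)%N ->
  (density R k l - delta) * m%:R ^+ k <= (exk k m [:: expanded_clique k l.+1])%:R.
Proof.
move=> /(balanced_cross k3 kl)[n0 h]; exists n0 => m nm.
have := h 'I_m; rewrite card_ord => /(_ nm)[c hc]; apply: le_trans hc _.
by rewrite ler_nat -[X in exk _ X](card_ord m) exk_ge_cross.
Qed.

(* By exact_bound a complete l-partite graph is extremal; clone a vertex of
   maximum degree in it. *)
Lemma exk_step : exists (c0 : R) (m0 : nat), 0 < c0 /\ forall m, (m0 <= m)%N ->
  (exk k m [:: expanded_clique k l.+1])%:R + c0 * m%:R ^+ (k - 1) <=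
  (exk k m.+1 [:: expanded_clique k l.+1])%:R.
Proof.
have k0 : (0 < k)%N by apply: leq_trans k3.
have d0 := density_gt0 R kl k0.
have d20 : 0 < density R k l / 2 by rewrite divr_gt0.
have [n1 h1] := exact_bound R k3 kl.
have [n2 h2] := exk_ge_density d20.
(* The average degree is k times the number of crossing sets over m, and that number is at least
   [density / 2 * m ^ k]. *)
exists (density R k l / 2 * k%:R), (maxn (maxn n1 n2) 1); split.
  by rewrite mulr_gt0 // ltr0n.
move=> m; rewrite !geq_max => /andP[/andP[m1 m2] m0].
have [c hc] : exists c : 'I_m -> 'I_l, (exk k m [:: expanded_clique k l.+1] <= #|cross c k|)%N.
  have [->|[E [Ek Ef <-]]] := exk_witness k m [:: expanded_clique k l.+1].
    have [c _] := balanced_coloring 'I_m (leq_trans k0 kl).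
    by exists c.
  by apply: h1; rewrite ?card_ord //; move: Ef; rewrite /= andbT.
case: (@arg_maxnP _ (Ordinal m0) xpredT (deg (cross c k)) isT) => v _ hv.
have [c' hc'] := cross_clone c v k0.
have := exk_ge_cross k c'; rewrite card_option card_ord => hex.
apply: (@le_trans _ _ (#|cross c k| + deg (cross c k) v)%N%:R); last first.
  by rewrite ler_nat (leq_trans hc').
rewrite natrD lerD ?ler_nat //.
have m0' : 0 < m%:R :> R by rewrite ltr0n.
rewrite -(ler_pM2l m0') -natrM.
apply: (@le_trans _ _ (\sum_u deg (cross c k) u)%N%:R); last first.
  rewrite ler_nat -[X in (_ <= X * _)%N](card_ord m) -sum_nat_const.
  by apply: leq_sum => u _; apply: hv.
rewrite (sum_deg (cross_uniform _ _)) natrM.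
have := le_trans (h2 m m2) (_ : _ <= #|cross c k|%:R); rewrite ler_nat => /(_ hc).
rewrite -[in X in X -> _](subn0 k) expr_subS // subn0 => h.
have -> : m%:R * (density R k l / 2 * k%:R * m%:R ^+ (k - 1)) =
  density R k l / 2 * (m%:R * m%:R ^+ (k - 1)) * k%:R by ring.
rewrite ler_wpM2r //; lra.
Qed.

Lemma exk_steps : exists (c0 : R) (m0 : nat), 0 < c0 /\ forall m x, (m0 <= m)%N ->
  (exk k m [:: expanded_clique k l.+1])%:R + x%:R * (c0 * m%:R ^+ (k - 1)) <=
  (exk k (m + x) [:: expanded_clique k l.+1])%:R.
Proof.
have [c0 [m0 [c00 h]]] := exk_step; exists c0, m0; split=> // m x mm.
elim: x => [|x IH]; first by rewrite mul0r addr0 addn0.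
have := h (m + x)%N (leq_trans mm (leq_addr _ _)); rewrite addnS; apply: le_trans.
have : c0 * m%:R ^+ (k - 1) <= c0 * (m + x)%:R ^+ (k - 1).
  by rewrite ler_wpM2l ?(ltW c00) // ler_expr // ler_nat leq_addr.
rewrite -natr1; lra.
Qed.

End Extremal.

(** * Near-perfect matchings *)

Section WrapAround.

Lemma prefix_sum_interval (u : nat -> nat) l x : x < \sum_(q < l) u q ->
  exists2 p, p < l & \sum_(q < p) u q <= x < \sum_(q < p.+1) u q.
Proof.
elim: l => [|l IH]; first by rewrite big_ord0.
case: (ltnP x (\sum_(q < l) u q)) => [/IH[p pl hp] _|lx xl].
  by exists p => //; apply: ltnW.
by exists l => //; rewrite lx.
Qed.

(* Lay the colours out in consecutive blocks of lengths u p <= m, and let row j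
   consist of the positions congruent to j modulo m. *)
Lemma wrap_around (u : nat -> nat) k l m : k * m <= \sum_(q < l) u q ->
  (forall p, p < l -> u p <= m) ->
  exists tau : 'I_m -> 'I_k -> 'I_l, (forall j, injective (tau j)) /\
    forall p, #|[set q : 'I_m * 'I_k | tau q.1 q.2 == p]| <= u p.
Proof.
move=> km um.
have pos_lt (j : 'I_m) (i : 'I_k) : i * m + j < k * m.
  by apply: leq_trans (leq_mul (ltn_ord i) (leqnn m)); rewrite mulSn addnC ltn_add2r.
have hex (j : 'I_m) (i : 'I_k) : exists p : 'I_l,
    \sum_(q < p) u q <= i * m + j < \sum_(q < p.+1) u q.
  have [p pl hp] := prefix_sum_interval (leq_trans (pos_lt j i) km).
  by exists (Ordinal pl).
pose tau j i := xchoose (hex j i).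
have tauP j i : \sum_(q < tau j i) u q <= i * m + j < \sum_(q < tau j i) u q + u (tau j i).
  by have := xchooseP (hex j i); rewrite -/(tau j i) big_ord_recr.
exists tau; split=> [j|p].
  (* Positions of one row are at least m apart and no block is longer than m, so a row meets each
     colour at most once. *)
  have lt (i i' : 'I_k) : i < i' -> tau j i != tau j i'.
    move=> ii'; apply/eqP => e; have /andP[h1 h2] := tauP j i.
    have /andP[h3 h4] := tauP j i'; rewrite e in h1 h2.
    have um' := um _ (ltn_ord (tau j i')).
    have : i'  * m >= i * m + m by rewrite addnC -mulSn leq_mul.
    move: h1 h4 um'; set S := \sum_(q < _) _; lia.
  move=> i i' e; apply: val_inj => /=; case: (ltngtP i i') => // /lt.
    by rewrite e eqxx.
  by rewrite e eqxx.
set A := [set _ | _].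
have hA q : q \in A -> \sum_(r < p) u r <= q.2 * m + q.1 < \sum_(r < p) u r + u p.
  by rewrite inE => /eqP <-; apply: tauP.
case up : (u p) => [|up'].
  rewrite leqn0 cards_eq0; apply/eqP/setP => q; rewrite in_set0; apply/negP => /hA.
  by rewrite up addn0 ltnNge; case/andP => ->.
pose h (q : 'I_m * 'I_k) : 'I_up'.+1 := inord (q.2 * m + q.1 - \sum_(r < p) u r).
rewrite -[X in _ <= X]card_ord -(@card_in_imset _ _ h A) ?max_card // => q q' qA qA' /(congr1 (@nat_of_ord _)).
have /andP[h1 h2] := hA q qA; have /andP[h3 h4] := hA q' qA'.
rewrite /h !inordK; last by rewrite -up ltn_subLR.
  move=> e; have {}e : q.2 * m + q.1 = q'.2 * m + q'.1.
    by rewrite -(subnK h1) -(subnK h3) e.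
  have m0 : 0 < m by apply: leq_ltn_trans (ltn_ord q.1).
  have e1 : q.1 = q'.1.
    by apply: val_inj; move/(congr1 (modn^~ m)): e; rewrite !modnMDl !modn_small.
  have e2 : q.2 = q'.2.
    apply: val_inj; apply/eqP; rewrite -(eqn_pmul2r m0).
    by move/eqP: e; rewrite e1 eqn_add2r.
  by move: e1 e2; case: (q) (q') => [a b] [a' b'] /= -> ->.
by rewrite -up ltn_subLR.
Qed.

(** The fibres are matched by rank in their enumerations; [b0] is only the default value of
    [nth]. *)
Lemma injection_over (A B P : finType) (f : A -> P) (h : B -> P) (U : {set B}) (b0 : B) :
  (forall p, #|[set a | f a == p]| <= #|[set b in U | h b == p]|) ->
  exists g : A -> B, [/\ injective g, forall a, g a \in U & forall a, h (g a) = f a].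
Proof.
move=> hc; pose As p := [set a | f a == p]; pose Bs p := [set b in U | h b == p].
pose g a := nth b0 (enum (Bs (f a))) (index a (enum (As (f a)))).
have aA a : a \in enum (As (f a)) by rewrite mem_enum inE.
have lt a : index a (enum (As (f a))) < size (enum (Bs (f a))).
  by rewrite -cardE; apply: leq_trans (hc (f a)); rewrite [X in _ < X]cardE index_mem.
have gB a : g a \in Bs (f a) by rewrite -mem_enum mem_nth.
have hg a : h (g a) = f a by have := gB a; rewrite inE => /andP[_ /eqP].
exists g; split=> // [a a' e|a]; last by have := gB a; rewrite inE => /andP[].
have ff : f a = f a' by rewrite -!hg e.
move/eqP: e; rewrite /g -ff nth_uniq ?enum_uniq //; last by rewrite ff; apply: lt.
have a'A : a' \in enum (As (f a)) by rewrite ff.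
by move=> /eqP e; rewrite -(nth_index a (aA a)) e nth_index.
Qed.

End WrapAround.

(** * Colour patterns of crossing edges *)

Section Types.
Variables k l : nat.

Definition inj_types := [set f : {ffun 'I_k -> 'I_l} | injectiveb f].
(** The number of vertices of colour p used by a table with one row of each pattern. *)
Definition type_count p := #|[set q : {ffun 'I_k -> 'I_l} * 'I_k |
   (q.1 \in inj_types) && (q.1 q.2 == p)]|.

Lemma card_inj_types : #|inj_types| = l ^_ k.
Proof. by rewrite /inj_types card_inj_ffuns !card_ord. Qed.

Lemma type_count_sym p q : type_count p = type_count q.
Proof.
pose h (x : {ffun 'I_k -> 'I_l} * 'I_k) := ([ffun i => tperm p q (x.1 i)], x.2).
have hK : cancel h h.
  by move=> [f i]; rewrite /h /=; congr (_, _); apply/ffunP => j; rewrite !ffunE tpermK.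
rewrite /type_count -(card_imset _ (can_inj hK)); apply: eq_card => x.
have inj (f : {ffun 'I_k -> 'I_l}) : ([ffun i => tperm p q (f i)] \in inj_types) = (f \in inj_types).
  rewrite !inE; apply/injectiveP/injectiveP => fi i j; last by rewrite !ffunE => /perm_inj/fi.
  by move=> fij; apply: fi; rewrite !ffunE fij.
apply/imsetP/idP => [[y + ->]|].
  rewrite inE => /andP[yi /eqP yp].
  by rewrite inE /= inj yi ffunE yp tpermL eqxx.
rewrite inE => /andP[xi /eqP xq]; exists (h x); last by rewrite hK.
by rewrite inE /= inj xi ffunE xq tpermR eqxx.
Qed.

Lemma type_count_mul p : l * type_count p = k * l ^_ k.
Proof.
transitivity (\sum_(q < l) type_count q).
  rewrite (eq_bigr (fun=> type_count p)) ?sum_nat_const ?card_ord // => q _.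
  exact: type_count_sym.
transitivity #|setX inj_types [set: 'I_k]|; last first.
  by rewrite cardsX cardsT card_ord card_inj_types mulnC.
rewrite -[RHS]sum1_card (partition_big (fun x : {ffun 'I_k -> 'I_l} * 'I_k => x.1 x.2) xpredT) //=.
apply: eq_bigr => q _; rewrite /type_count -sum1_card; apply: eq_bigl => x.
by rewrite !inE andbT.
Qed.

End Types.

Lemma leq_ffact2r n m j : n <= m -> n ^_ j <= m ^_ j.
Proof.
by move=> nm; rewrite !ffact_prod; apply: leq_prod => i _; apply: leq_sub2r.
Qed.

Lemma leq_expn_ffact n j : (n - j) ^ j <= n ^_ j.
Proof.
rewrite ffact_prod -[X in _ ^ X](card_ord j) -prod_nat_const.
by apply: leq_prod => i _; apply: leq_sub2l; apply: ltnW.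
Qed.

(** * Repairing a table of rows by switching *)

Section Switching.
Variables (V : finType) (l k' : nat) (E : {set {set V}}) (c : V -> 'I_l) (U : {set V}).
Notation k := k'.+1.
Variables (J : finType) (tau : J -> 'I_k -> 'I_l) (d q : nat).
Hypotheses (tau_inj : forall j, injective (tau j))
  (tau_many : forall j, q <= #|[set j' | (j' != j) && [forall i, tau j' i == tau j i]]|)
  (few_bad : forall v, v \in U -> deg (cross c k :\: E) v <= d)
  (kdq : k * d < q ^_ k').

Definition arrangement (g : {ffun J * 'I_k -> V}) :=
  [&& injectiveb g, [forall x, g x \in U] & [forall x, c (g x) == tau x.1 x.2]].
Definition row_of (g : {ffun J * 'I_k -> V}) j := [set g (j, i) | i : 'I_k].

(* A bad row j0 is repaired by cyclically shifting the columns of the k rows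
   j0, r 0, ..., r (k - 2), for distinct rows r i of the same type as j0.  Each
   of the k shifted rows contains exactly one vertex of row j0, so few choices
   of r leave one of them bad. *)
Lemma switch_row g j0 : arrangement g -> row_of g j0 \notin E ->
  exists2 g', arrangement g' & #|[set j | row_of g j \in E]| < #|[set j | row_of g' j \in E]|.
Proof.
case/and3P=> /injectiveP gi /forallP gU /forallP gc gj0.
pose R := [set j' | (j' != j0) && [forall i, tau j' i == tau j0 i]].
(* [rr r] lists k rows, with [j0] at index 0, and [X r b] is row b after column i has been shifted
   by i; indices are added modulo k. *)
pose rr (r : {ffun 'I_k' -> J}) (b : 'I_k) := oapp r j0 (unlift ord0 b).
pose X r b := [set g (rr r (b + i)%R, i) | i : 'I_k].
pose Rs := [set r : {ffun 'I_k' -> J} in ffun_on R | injectiveb r].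
have rr_tau r b i : r \in Rs -> tau (rr r b) i = tau j0 i.
  rewrite inE => /andP[/ffun_onP rR _]; rewrite /rr; case: (unlift ord0 b) => //= b'.
  by have := rR b'; rewrite inE => /andP[_ /forallP/(_ i)/eqP].
have rr_inj r : r \in Rs -> injective (rr r).
  rewrite inE => /andP[/ffun_onP rR /injectiveP ri] b b'.
  have rj x : r x != j0 by have := rR x; rewrite inE => /andP[].
  rewrite /rr; case: (unliftP ord0 b) => [x|] ->; case: (unliftP ord0 b') => [y|] ->;
    rewrite ?liftK ?unlift_none //=.
  - by move=> /ri ->.
  - by move=> /eqP; rewrite (negPf (rj x)).
  - by move=> /esym/eqP; rewrite (negPf (rj y)).
have X_cross r b : r \in Rs -> X r b \in cross c k.
  move=> rRs; apply/crossP; split.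
    by rewrite card_imset ?card_ord // => i i' /gi [].
  move=> _ _ /imsetP[i _ ->] /imsetP[i' _ ->]; rewrite !(eqP (gc _)) /= !rr_tau //.
  by move=> /(@tau_inj j0) ->.
(* In column -b the set [X r b] contains a vertex of row [j0] independent of r, and the set
   determines r. Hence the bad r inject into the missing crossing sets through that vertex. *)
have X_bad b : #|[set r in Rs | X r b \notin E]| <= d.
  apply: leq_trans (few_bad (gU (j0, (- b)%R))).
  rewrite -(@card_in_imset _ _ (X^~ b)).
    apply/subset_leq_card/subsetP => S /imsetP[r]; rewrite inE => /andP[rRs rE] ->.
    rewrite inE in_setD rE X_cross //=; apply/imsetP; exists (- b)%R => //.
    by rewrite GRing.subrr /rr unlift_none.
  move=> r r' /setIdP[rRs _] /setIdP[rRs' _] XX; apply/ffunP => x.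
  have : g (rr r (b + (lift ord0 x - b))%R, (lift ord0 x - b)%R) \in X r' b.
    by rewrite -[X r' b]XX; apply: imset_f.
  case/imsetP=> i _ /gi [+ e]; rewrite -e addrC subrK.
  by rewrite /rr liftK.
have /subsetPn[r rRs rbad] : ~~ (Rs \subset \bigcup_b [set r in Rs | X r b \notin E]).
  apply/negP => /subset_leq_card; rewrite leqNgt => /negP[].
  apply: (@leq_ltn_trans (k * d)).
    rewrite -[X in X * d](card_ord k) -cardsT.
    apply: (@card_exists_le _ _ setT (fun b => [set r in Rs | X r b \notin E])).
      by move=> r /bigcupP[b _ rb]; exists b.
    by move=> b _; apply: X_bad.
  apply: (leq_trans kdq); rewrite card_inj_ffuns_on card_ord.
  exact/leq_ffact2r/tau_many.
have XE b : X r b \in E.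
  by apply: contraNT rbad => nE; apply/bigcupP; exists b; rewrite // inE rRs.
pose sg i j := if [pick b | rr r b == j] is Some b then rr r (b + i)%R else j.
have sg_rr i b : sg i (rr r b) = rr r (b + i)%R.
  rewrite /sg; case: pickP => [b' /eqP/(rr_inj _ rRs) -> //|/(_ b)].
  by rewrite eqxx.
have sg_id i j : (forall b, rr r b != j) -> sg i j = j.
  by rewrite /sg; case: pickP => // b /eqP e /(_ b); rewrite e eqxx.
have rrP j : (exists b, j = rr r b) \/ (forall b, rr r b != j).
  case: (pickP (fun b => rr r b == j)) => [b /eqP <-|h]; first by left; exists b.
  by right=> b; rewrite h.
have sg_inj i : injective (sg i).
  move=> j j'; case: (rrP j) => [[b ->]|hj]; case: (rrP j') => [[b' ->]|hj'];
    rewrite ?sg_rr ?sg_id //.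
  - by move=> /(rr_inj _ rRs)/addIr ->.
  - by move=> e; have := hj' (b + i)%R; rewrite e eqxx.
  - by move=> e; have := hj (b' + i)%R; rewrite e eqxx.
have sg_tau i j : tau (sg i j) i = tau j i.
  by case: (rrP j) => [[b ->]|hj]; rewrite ?sg_rr ?sg_id // !rr_tau.
pose g' := [ffun x : J * 'I_k => g (sg x.2 x.1, x.2)].
have row_id j : (forall b, rr r b != j) -> row_of g' j = row_of g j.
  by move=> hj; apply: eq_imset => i; rewrite ffunE /= sg_id.
have row_rr b : row_of g' (rr r b) = X r b.
  by apply: eq_imset => i; rewrite ffunE /= sg_rr.
exists g'; first apply/and3P; first split.
- apply/injectiveP => -[j i] [j' i']; rewrite !ffunE /= => /gi [+ ii'].
  by rewrite -ii' => /sg_inj ->.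
- by apply/forallP => x; rewrite ffunE gU.
- by apply/forallP => x; rewrite ffunE (eqP (gc _)) /= sg_tau.
apply: proper_card; rewrite properE; apply/andP; split.
  apply/subsetP => j; rewrite !inE.
  by case: (rrP j) => [[b ->]|hj]; rewrite ?row_rr ?XE ?row_id.
apply/subsetPn; exists j0; rewrite inE //.
have -> : j0 = rr r ord0 by rewrite /rr unlift_none.
by rewrite row_rr XE.
Qed.

Lemma arrangement_complete g0 : arrangement g0 ->
  exists2 g, arrangement g & forall j, row_of g j \in E.
Proof.
move=> g0P.
case: (@arg_maxnP _ g0 arrangement (fun g => #|[set j | row_of g j \in E]|) g0P) => g gP gmax.
exists g => // j; apply: contraT => /(switch_row gP)[g' /gmax].
by rewrite /= leqNgt => /negPf->.
Qed.

Lemma arrangement_matching g0 : arrangement g0 -> exists M : {set {set V}},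
  [/\ M \subset E, trivIset M, cover M \subset U & #|M| = #|J|].
Proof.
move=> /arrangement_complete[g /and3P[/injectiveP gi /forallP gU _] gE].
have disj j j' : j != j' -> [disjoint row_of g j & row_of g j'].
  move=> jj'; rewrite -setI_eq0; apply/eqP/setP => x; rewrite in_set0.
  apply/negP => /setIP[/imsetP[i _ ->] /imsetP[i' _ /gi [e]]].
  by rewrite e eqxx in jj'.
have ri : injective (row_of g).
  move=> j j' e; apply/eqP; apply: contraT => /disj.
  rewrite e -setI_eq0 setIid => /eqP/setP/(_ (g (j', ord0))).
  by rewrite in_set0 [_ \in row_of _ _]imset_f.
exists [set row_of g j | j : J]; split.
- by apply/subsetP => _ /imsetP[j _ ->].
- apply/trivIsetP => _ _ /imsetP[j _ ->] /imsetP[j' _ ->] jj'.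
  by apply: disj; apply: contraNneq jj' => ->.
- apply/subsetP => x /bigcupP[_ /imsetP[j _ ->] /imsetP[i _ ->]]; exact: gU.
- by rewrite card_imset.
Qed.

End Switching.

(** The table has t reserve rows of every pattern and m rows for the surplus, arranged by
    [wrap_around]. Every row thus has t - 1 other rows of its own pattern for switching. *)
Lemma matching_of_type_counts (V : finType) (l k' : nat) (E : {set {set V}})
    (c : V -> 'I_l) (U : {set V}) (t d m : nat) (b0 : V) :
  let k := k'.+1 in
  (forall p, t * type_count k p <= #|[set v in U | c v == p]|) ->
  k * m <= \sum_p (#|[set v in U | c v == p]| - t * type_count k p) ->
  (forall p, #|[set v in U | c v == p]| - t * type_count k p <= m) ->
  (forall v, v \in U -> deg (cross c k :\: E) v <= d) ->
  k * d < (t - 1) ^_ k' ->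
  exists M : {set {set V}}, [/\ M \subset E, trivIset M, cover M \subset U &
    #|M| = t * l ^_ k + m].
Proof.
move=> k hp hm hpm hd hkd.
case: (posnP l) => [l0|l_gt0].
  by case: (c b0) => x; rewrite l0.
pose i0 : 'I_l := Ordinal l_gt0.
pose u p := if insub p is Some p' then #|[set v in U | c v == p']| - t * type_count k p'
  else 0.
have uE (p : 'I_l) : u p = #|[set v in U | c v == p]| - t * type_count k p.
  by rewrite /u valK.
have [||tau' [tau'i tau'c]] := @wrap_around u k l m.
- by under eq_bigr do rewrite uE.
- by move=> p pl; rewrite -[p]/(val (Ordinal pl)) uE.
pose J : finType := ({f : {ffun 'I_k -> 'I_l} | f \in inj_types k l} * 'I_t + 'I_m)%type.
pose tau (j : J) (i : 'I_k) : 'I_l :=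
  match j with inl (f, _) => val f i | inr j => tau' j i end.
have tau_inj j : injective (tau j).
  case: j => [[f a]|j]; last exact: tau'i.
  by have := valP f; rewrite inE => /injectiveP.
have tau_many j : t - 1 <= #|[set j' | (j' != j) && [forall i, tau j' i == tau j i]]|.
  have fj : finfun (tau j) \in inj_types k l.
    by rewrite inE; apply/injectiveP => x y; rewrite !ffunE => /tau_inj.
  pose S := [set (inl (exist _ (finfun (tau j)) fj, a) : J) | a : 'I_t].
  have St : #|S| = t by rewrite card_imset ?card_ord // => a b [].
  apply: (@leq_trans #|S :\ j|).
    by rewrite leq_subLR -[in X in X <= _]St (cardsD1 j S) leq_add2r leq_b1.
  apply/subset_leq_card/subsetP => x /setD1P[xj /imsetP[a _ xa]].
  by rewrite inE xj xa; apply/forallP => i; rewrite /= ffunE.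
have hcount p : #|[set x : J * 'I_k | tau x.1 x.2 == p]| <= #|[set v in U | c v == p]|.
  pose psi (x : J * 'I_k) : ({ffun 'I_k -> 'I_l} * 'I_k) * 'I_t + 'I_m * 'I_k :=
    match x.1 with inl (f, a) => inl ((val f, x.2), a) | inr j => inr (j, x.2) end.
  have psi_inj : injective psi.
    by move=> [[[f a]|j] i] [[[f' a']|j'] i'] // [] => [/val_inj -> -> ->|-> ->].
  pose S1 := [set q : {ffun 'I_k -> 'I_l} * 'I_k | (q.1 \in inj_types k l) && (q.1 q.2 == p)].
  pose S2 := [set q : 'I_m * 'I_k | tau' q.1 q.2 == p].
  apply: (@leq_trans (#|setX S1 [set: 'I_t]| + #|S2|)); last first.
    rewrite cardsX cardsT card_ord -(subnKC (hp p)) mulnC leq_add2l -uE.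
    exact: tau'c.
  rewrite -(card_imset _ psi_inj) -(card_imset (mem (setX S1 [set: 'I_t])) (@inl_inj _ ('I_m * 'I_k)%type)).
  rewrite -(card_imset (mem S2) (@inr_inj (({ffun 'I_k -> 'I_l} * 'I_k) * 'I_t)%type _)).
  apply: leq_trans (leq_card_setU _ _).
  apply/subset_leq_card/subsetP => y /imsetP[[[[f a]|j] i]]; rewrite inE /= => hx ->.
    rewrite inE; apply/orP; left; apply: imset_f.
    by rewrite in_setX in_setT andbT inE /= hx andbT; apply: (valP f).
  by rewrite inE; apply/orP; right; apply: imset_f; rewrite inE.
have [g [gi gU gc]] := injection_over (U := U) (h := c) b0 hcount.
have [|M [ME Mt MU Mc]] := @arrangement_matching V l k' E c U J tau d (t - 1)
    tau_inj tau_many hd hkd (finfun g).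
  apply/and3P; split.
  - by apply/injectiveP => x y; rewrite !ffunE => /gi.
  - by apply/forallP => x; rewrite ffunE.
  - by apply/forallP => x; rewrite ffunE gc.
exists M; split=> //; rewrite Mc card_sum card_prod card_sig !card_ord.
by rewrite card_inj_types mulnC.
Qed.

Lemma matching_contains (V : finType) k (E M : {set {set V}}) m :
  uniform k E -> M \subset E -> trivIset M -> m <= #|M| ->
  contains (Hypergraph E) (matching k m).
Proof.
move=> /uniformP Ek /subsetP ME /trivIsetP Mt mM.
pose e (i : 'I_m) := enum_val (widen_ord mM i).
have eM i : e i \in M by apply: enum_valP.
have ek i : k = #|e i| by rewrite Ek ?ME.
pose f (x : 'I_m * 'I_k) := enum_val (cast_ord (ek x.1) x.2).
have fe x : f x \in e x.1 by apply: enum_valP.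
have ei : injective e by move=> i j /enum_val_inj/(congr1 (@nat_of_ord _)) /= /ord_inj.
apply/existsP; exists (finfun f); apply/andP; split.
  apply/injectiveP => -[i a] [j b]; rewrite !ffunE => fab.
  have ij : i = j.
    apply/eqP; apply: contraT => ij; have /Mt : e i != e j by rewrite (inj_eq ei).
    move=> /(_ (eM i) (eM j))/disjointFr/(_ (fe (i, a))).
    by rewrite fab (fe (j, b)).
  by move: fab; rewrite -ij => /enum_val_inj/cast_ord_inj /= ->.
apply/forall_inP => _ /imsetP[i _ ->]; rewrite -imset_comp.
rewrite (_ : _ @: _ = e i) ?ME //.
apply/eqP; rewrite eqEcard -(ek i) card_imset ?card_ord ?leqnn ?andbT.
  by apply/subsetP => _ /imsetP[j _ ->]; rewrite /= ffunE.
by move=> a b; rewrite /= !ffunE => /enum_val_inj/cast_ord_inj.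
Qed.

(** * Near-perfect matchings in nearly complete l-partite hypergraphs *)

Section NearPerfect.
Local Open Scope ring_scope.
Variable R : realType.
Variables k l : nat.
Hypotheses (k3 : (2 < k)%N) (kl : (k < l)%N).

Lemma sum_class_in (V : finType) (c : V -> 'I_l) (U : {set V}) :
  (\sum_p #|[set v in U | c v == p]| = #|U|)%N.
Proof.
rewrite -[RHS]sum1_card (partition_big c xpredT) //=; apply: eq_bigr => p _.
by rewrite -sum1_card; apply: eq_bigl => v; rewrite inE.
Qed.

Lemma near_perfect_matching : exists (eta t0 : R) (n0 : nat), [/\ 0 < eta, 0 < t0 &
  forall (V : finType) (E : {set {set V}}) (c : V -> 'I_l) (U : {set V}),
  (n0 <= #|V|)%N ->
  (forall p, `| #|[set v in U | c v == p]|%:R - #|V|%:R / l%:R | <= eta * #|V|%:R) ->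
  (forall v, v \in U -> (deg (cross c k :\: E) v)%:R <= t0 * #|V|%:R ^+ (k - 1)) ->
  exists M : {set {set V}}, [/\ M \subset E, trivIset M, cover M \subset U &
    #|M| = (#|U| %/ k)%N]].
Proof.
have k_gt0 : (0 < k)%N by apply: leq_trans k3.
have l_gt0 : (0 < l)%N by apply: leq_trans kl.
have [T hT] : exists T, T = (l ^_ k)%N by exists (l ^_ k)%N.
have T_gt0 : (0 < T)%N by rewrite hT ffact_gt0 ltnW.
have K1 : 1 <= k%:R :> R by rewrite ler1n.
have LK : k%:R + 1 <= l%:R :> R by rewrite natr1 ler_nat.
have K0 : 0 < k%:R :> R by rewrite ltr0n.
have L0 : 0 < l%:R :> R by rewrite ltr0n.
have T0 : 0 < T%:R :> R by rewrite ltr0n.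
pose x0 : R := (4 * k%:R * T%:R)^-1.
have x00 : 0 < x0 by rewrite invr_gt0 !mulr_gt0.
have [n1 hn1] := exists_nat_ge (4 * (k%:R * l%:R) : R).
have [n2 hn2] := exists_nat_ge ((k%:R + 1) / x0 : R).
(* With h = n/(kl), the first constant bounds class deviations by h/(8l). The reserve uses about
   half of the vertices, so t is about [2 * x0 * n]; hence [(x0 * n) ^ (k - 1)] is below the number
   of switchings, and the second constant makes k times the missing degree at most half of it. *)
exists ((8 * (k%:R * l%:R * l%:R))^-1), (x0 ^+ (k - 1) / (2 * k%:R)), (maxn n1 n2.+1).
split; first by rewrite invr_gt0 !mulr_gt0.
  by rewrite divr_gt0 ?mulr_gt0 ?exprn_gt0.
move=> V E c U; rewrite geq_max => /andP[/hn1 {}hn1 n2V].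
have /hn2 {}hn2 := ltnW n2V.
set n := #|V| in hn1 n2V hn2 *.
have n_gt0 : (0 < n)%N by apply: leq_ltn_trans n2V.
have n0 : 0 < n%:R :> R by rewrite ltr0n.
have [b0 _] : exists b0 : V, b0 \in V by apply/card_gt0P.
pose Up p := #|[set v in U | c v == p]|.
pose h : R := n%:R / (k%:R * l%:R).
have h4 : 4 <= h by rewrite ler_pdivlMr ?mulr_gt0.
have -> : n%:R / l%:R = h * k%:R :> R by rewrite /h; field; rewrite !gt_eqF.
have -> : (8 * (k%:R * l%:R * l%:R))^-1 * n%:R = h / (8 * l%:R) :> R.
  by rewrite /h; field; rewrite !gt_eqF.
move=> hU hdeg.
have nh : n%:R = h * k%:R * l%:R :> R by rewrite /h; field; rewrite !gt_eqF.
pose t := (n %/ (2 * k * T))%N.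
have tn : t%:R * (2 * k%:R * T%:R) <= n%:R :> R.
  by rewrite -!natrM ler_nat leq_trunc_div.
have tn' : n%:R < (t%:R + 1) * (2 * k%:R * T%:R) :> R.
  by rewrite natr1 -!natrM ltr_nat ltn_ceil // !muln_gt0 k_gt0 T_gt0.
pose w : R := t%:R * T%:R.
have wh : w <= h * l%:R / 2.
  rewrite ler_pdivlMr // -(ler_pM2r K0); move: tn; rewrite nh /w; lra.
have w0 : 0 <= w by rewrite mulr_ge0.
have cntE (p : 'I_l) : (t * type_count k p)%N%:R = w * k%:R / l%:R :> R.
  have := type_count_mul k p; rewrite -hT => /(congr1 (fun x => x%:R : R)).
  rewrite /= !natrM => e; apply: (mulfI (lt0r_neq0 L0)).
  by rewrite mulrCA e /w; field; rewrite gt_eqF.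
have UpP p : h * k%:R - h / (8 * l%:R) <= (Up p)%:R :> R /\
    (Up p)%:R <= h * k%:R + h / (8 * l%:R) :> R.
  by have := hU p; rewrite distrC ler_distlC => /andP.
have h8 : h / (8 * l%:R) <= h / 8.
  rewrite ler_wpM2l ?(le_trans _ h4) // lef_pV2 ?posrE ?mulr_gt0 //.
  by rewrite ler_peMr //; lra.
have hUsum : h * k%:R * l%:R - h / 8 <= #|U|%:R :> R.
  rewrite -(sum_class_in c U) natr_sum.
  apply: (@le_trans _ _ (\sum_(p < l) (h * k%:R - h / (8 * l%:R)))).
    rewrite sumr_const card_ord -mulr_natr le_eqVlt; apply/orP; left; apply/eqP.
    by field; rewrite gt_eqF.
  by apply: ler_sum => p _; case: (UpP p).
pose Q := (#|U| %/ k)%N.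
have Qk : #|U|%:R <= (Q%:R + 1) * k%:R :> R.
  by rewrite natr1 -natrM ler_nat ltnW // ltn_ceil.
have hhL : h * k%:R + h <= h * l%:R.
  by have := ler_wpM2l (le_trans (ler0n R 4) h4) LK; lra.
have hhK : h <= h * k%:R.
  by have := ler_wpM2l (le_trans (ler0n R 4) h4) K1; lra.
have Qh : h * l%:R - h / 8 <= Q%:R + 1 :> R.
  rewrite -(ler_pM2r K0); apply: le_trans Qk; apply: le_trans hUsum.
  by move: hhK; lra.
have tTQ : (t * T <= Q)%N by rewrite -(ler_nat R) natrM -/w; lra.
pose r : R := k%:R / l%:R.
have r1 : 0 <= 1 - r by rewrite subr_ge0 ler_pdivrMr // mul1r; lra.
have hr : h * l%:R / 2 * (1 - r) = h * l%:R / 2 - h * k%:R / 2.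
  by rewrite /r; field; rewrite gt_eqF.
have wr := ler_wpM2r r1 wh; rewrite hr in wr.
have wrE : w * k%:R / l%:R = w * r by rewrite /r mulrA.
have k1 : (k - 1).+1 = k by rewrite subn1 prednK.
pose d := Num.trunc (x0 ^+ (k - 1) / (2 * k%:R) * n%:R ^+ (k - 1)).
have := @matching_of_type_counts V l (k - 1) E c U t d (Q - t * T)%N b0.
rewrite /= k1 -hT => hM.
have r0 : 0 <= r by rewrite divr_ge0.
have wr2 : w * r <= h * k%:R / 2.
  apply: le_trans (ler_wpM2r r0 wh) _; rewrite le_eqVlt; apply/orP; left; apply/eqP.
  by rewrite /r; field; rewrite gt_eqF.
have cntU (p : 'I_l) : (t * type_count k p <= Up p)%N.
  by rewrite -(ler_nat R) cntE wrE; case: (UpP p) => + _; apply: le_trans; lra.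
have x0n : k%:R + 1 <= x0 * n%:R by rewrite mulrC -ler_pdivrMr.
have tx0 : x0 * n%:R + k%:R < t%:R.
  suff : 2 * (x0 * n%:R) < t%:R + 1 by lra.
  rewrite -(ltr_pM2r (_ : 0 < 2 * k%:R * T%:R)) ?mulr_gt0 //.
  apply: le_lt_trans tn'; rewrite le_eqVlt; apply/orP; left; apply/eqP.
  by rewrite /x0; field; rewrite !gt_eqF.
have kt : (k <= t)%N.
  by rewrite -(ler_nat R); apply: ltW; apply: le_lt_trans tx0; lra.
case: hM => //.
- rewrite -(ler_nat R) natrM natrB // natrM -/w natr_sum.
  rewrite (eq_bigr (fun p => (Up p)%:R - w * r)); last first.
    by move=> p _; rewrite natrB ?cntU // cntE wrE.
  rewrite sumrB -natr_sum sum_class_in sumr_const card_ord mulrBr.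
  have -> : (w * r) *+ l = k%:R * w by rewrite -[LHS]mulr_natr /r; field; rewrite gt_eqF.
  by rewrite lerD2r -natrM ler_nat mulnC leq_trunc_div.
(* Here k < l is decisive: the surplus of a class lies below the number of surplus rows by about h
   (l - k) / 2, at least h/2, while the errors amount to at most h/4 + 1. Hence the requirement that
   h is at least 4. *)
- move=> p; rewrite leq_subLR -(ler_nat R) natrD cntE natrB // natrM -/w -/(Up p) wrE.
  by case: (UpP p) => _ up; apply: (le_trans up); lra.
- by move=> v /hdeg hv; apply: leq_trunc.
- rewrite -(ltr_nat R); apply: (@lt_le_trans _ _ ((x0 * n%:R) ^+ (k - 1))); last first.
    apply: (@le_trans _ _ (((t - 1) - (k - 1)) ^ (k - 1))%N%:R); last first.
      by rewrite ler_nat leq_expn_ffact.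
    rewrite natrX ler_expr ?mulr_ge0 ?(ltW x00) // -subnDA subnKC // natrB //; lra.
  have y0 : 0 < (x0 * n%:R) ^+ (k - 1) by rewrite exprn_gt0 // mulr_gt0.
  have d0 : 0 <= x0 ^+ (k - 1) / (2 * k%:R) * n%:R ^+ (k - 1).
    by rewrite mulr_ge0 ?divr_ge0 ?exprn_ge0 ?mulr_ge0 ?(ltW x00).
  rewrite natrM; apply: le_lt_trans (ler_wpM2l (ltW K0) (trunc_ler d0)) _.
  have -> : k%:R * (x0 ^+ (k - 1) / (2 * k%:R) * n%:R ^+ (k - 1)) = (x0 * n%:R) ^+ (k - 1) / 2.
    by rewrite exprMn; field; rewrite gt_eqF.
  lra.
move=> M [ME Mt MU Mc]; exists M; split=> //; rewrite Mc subnKC //.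
Qed.

End NearPerfect.

(** * Matchings through prescribed vertices *)

Section Matchings.
Variables (V : finType) (k : nat) (E : {set {set V}}).
Hypotheses (Ek : uniform k E) (k_gt0 : 0 < k).
Implicit Types (M : {set {set V}}) (Z B : {set V}).

Lemma card_cover_matching M : M \subset E -> trivIset M -> #|cover M| = k * #|M|.
Proof.
move=> /subsetP ME /eqP <-; rewrite mulnC -sum_nat_const; apply: eq_bigr => e /ME.
exact: (uniformP _ _ Ek).
Qed.

Lemma matching_union M1 M2 : M1 \subset E -> M2 \subset E -> trivIset M1 -> trivIset M2 ->
  [disjoint cover M1 & cover M2] ->
  trivIset (M1 :|: M2) /\ #|M1 :|: M2| = #|M1| + #|M2|.
Proof.
move=> M1E M2E t1 t2 d12.
have sub M e : e \in M -> e \subset cover M by move=> eM; apply: (bigcup_sup e).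
have d e f : e \in M1 -> f \in M2 -> [disjoint e & f].
  by move=> /sub e1 /sub f2; apply: disjointWl e1 _; apply: disjointWr f2 d12.
split.
  apply/trivIsetP => e f /setUP[eM|eM] /setUP[fM|fM] ef.
  - exact: (trivIsetP t1).
  - exact: d.
  - by rewrite disjoint_sym d.
  - exact: (trivIsetP t2).
rewrite cardsU (_ : M1 :&: M2 = set0) ?cards0 ?subn0 //.
apply/setP => e; rewrite in_set0; apply/negP => /setIP[e1 e2].
have := d e e e1 e2; rewrite -setI_eq0 setIid => /eqP e0.
by have := uniformP _ _ Ek _ (subsetP M1E e e1); rewrite e0 cards0 => k0; move: k_gt0; rewrite -k0.
Qed.

Lemma edge_avoiding Z v : v \notin Z -> #|Z| * #|V| ^ (k - 2) < deg E v ->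
  exists e, [/\ e \in E, v \in e & [disjoint e & Z]].
Proof.
move=> vZ h.
suff /exists_inP[e eE /andP[ve eZ]] : [exists e in E, (v \in e) && [disjoint e & Z]].
  by exists e.
apply: contraLR h => /exists_inPn h; rewrite -leqNgt.
apply: (@card_exists_le _ _ _ (fun u => [set e in E | (u \in e) && (v \in e)])).
  move=> e; rewrite inE => /andP[eE ve]; have := h e eE; rewrite ve /=.
  by case/pred0Pn => u /andP[/= ue uZ]; exists u; rewrite // inE eE ue ve.
by move=> u uZ; apply: cod_le => //; apply: contraNneq vZ => <-.
Qed.

(** At most |B| edges are chosen, so [|Z| + k * |B|] bounds the number of vertices to avoid at every
    stage. *)
Lemma greedy_cover B Z :
  (forall v, v \in B :\: Z -> (#|Z| + k * #|B|) * #|V| ^ (k - 2) < deg E v) ->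
  exists M, [/\ M \subset E, trivIset M, [disjoint cover M & Z],
    B \subset Z :|: cover M & #|M| <= #|B|].
Proof.
move=> hB.
suff h m : m <= #|B| -> exists M, [/\ M \subset E, trivIset M, [disjoint cover M & Z],
    #|B :\: (Z :|: cover M)| <= #|B| - m & #|M| <= m].
  have [M [ME Mt MZ MB Mc]] := h #|B| (leqnn _); exists M; split=> //.
  by move: MB; rewrite subnn leqn0 cards_eq0 setD_eq0.
elim: m => [|m IH] mB.
  exists set0; rewrite sub0set cards0 /cover big_set0 subn0; split=> //.
  - by apply/trivIsetP => e f; rewrite inE.
  - by rewrite -setI_eq0 set0I.
  - by rewrite subset_leq_card ?subsetDl.
have [M [ME Mt MZ MB Mc]] := IH (ltnW mB).
have [e0|/set0Pn[v /setDP[vB]]] := eqVneq (B :\: (Z :|: cover M)) set0.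
  by exists M; split=> //; [rewrite e0 cards0|apply: leqW].
move=> vX; move: (vX); rewrite in_setU negb_or => /andP[vZ vM].
have [|e [eE ve eX]] := edge_avoiding vX.
  apply: leq_ltn_trans (hB v _); last by rewrite inE vZ.
  rewrite leq_mul2r; apply/orP; right; apply: leq_trans (leq_card_setU _ _) _.
  by rewrite leq_add2l card_cover_matching // leq_mul2l (leq_trans Mc) ?orbT // ltnW.
have eE1 : [set e] \subset E by rewrite sub1set.
have ce : cover [set e] = e by rewrite /cover big_set1.
have et : trivIset [set e].
  by apply/trivIsetP => a b /set1P-> /set1P->; rewrite eqxx.
have eM : [disjoint cover [set e] & cover M].
  by rewrite ce; apply: disjointWr eX; apply: subsetUr.
have [t' c'] := matching_union eE1 ME et Mt eM.
have cU : cover (e |: M) = e :|: cover M.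
  by rewrite /cover bigcup_setU big_set1.
exists (e |: M); split=> //.
- by rewrite subUset eE1.
- rewrite cU disjoint_sym disjoints_subset setCU subsetI -!disjoints_subset.
  rewrite [X in _ && X]disjoint_sym MZ andbT disjoint_sym.
  by apply: disjointWr eX; apply: subsetUl.
- rewrite subnS -ltnS prednK ?subn_gt0 //; apply: leq_trans MB; apply: proper_card.
  rewrite properE cU; apply/andP; split.
    by rewrite setDS // setUS // subsetUr.
  apply/subsetPn; exists v; first by rewrite inE vX.
  by rewrite !inE ve !orbT.
- by rewrite c' cards1 add1n.
Qed.

End Matchings.

(** * Matchings avoiding a small exceptional set *)

Section AvoidingMatchings.
Local Open Scope ring_scope.
Variable R : realType.
Variables k l : nat.
Hypotheses (k3 : (2 < k)%N) (kl : (k < l)%N).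

Let k_gt0 : (0 < k)%N. Proof. by apply: leq_trans k3. Qed.
Let l_gt0 : (0 < l)%N. Proof. by apply: leq_trans kl. Qed.

Lemma matching_avoiding : exists (eta t0 : R) (n0 : nat), [/\ 0 < eta, 0 < t0 &
  forall (V : finType) (E : {set {set V}}) (c : V -> 'I_l) (Z : {set V}) (t g b : R),
  uniform k E -> (n0 < #|V|)%N -> t <= t0 ->
  (forall p, `| #|color_class c p|%:R - #|V|%:R / l%:R | <= eta * #|V|%:R) ->
  #|bad_vertices k E c t|%:R <= b * #|V|%:R ->
  (2 * k%:R + 1) * b < g -> (2 * k%:R + 1) * b <= eta ->
  (forall v, v \notin Z -> g * #|V|%:R ^+ (k - 1) <= (deg E v)%:R) ->
  #|Z|%:R <= (k%:R + 1) * b * #|V|%:R ->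
  exists M : {set {set V}}, [/\ M \subset E, trivIset M, [disjoint cover M & Z] &
    #|M| = ((#|V| - #|Z|) %/ k)%N]].
Proof.
have [eta [t0 [n0 [eta0 t00 hnp]]]] := near_perfect_matching R k3 kl.
exists (eta / 2), t0, n0; split=> //; first by rewrite divr_gt0.
move=> V E c Z t g b Ek n0V tt0 hc hB bg beta hg hZ.
set n := #|V| in n0V hc hB hg hZ *; set B := bad_vertices _ _ _ _ in hB.
have n_gt0 : 0 < n%:R :> R by rewrite ltr0n (leq_ltn_trans _ n0V).
have z0 : 0 < n%:R ^+ (k - 2) :> R by rewrite exprn_gt0.
have nk1 : n%:R ^+ (k - 1) = n%:R * n%:R ^+ (k - 2) :> R.
  by rewrite expr_subS // ltnW.
(* The factor 2k + 1 is k + 1 for Z plus k for the edges that cover the bad vertices. *)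
have hZB : #|Z|%:R + k%:R * #|B|%:R <= (2 * k%:R + 1) * b * n%:R.
  by have := ler_wpM2l (ler0n R k) hB; lra.
have [v vB|M1 [M1E M1t M1Z BM1 M1B]] := @greedy_cover V k E Ek k_gt0 B Z.
  rewrite -(ltr_nat R); have /setDP[_ /hg] := vB; apply: lt_le_trans.
  rewrite natrM natrX natrD natrM nk1 mulrA ltr_pM2r //.
  by apply: (le_lt_trans hZB); rewrite ltr_pM2r.
pose W := Z :|: cover M1; pose U := ~: W.
have cM1 := card_cover_matching Ek M1E M1t.
have cW : #|W| = (#|Z| + k * #|M1|)%N.
  by rewrite cardsU setIC (disjoint_setI0 M1Z) cards0 subn0 cM1.
have hW : #|W|%:R <= eta / 2 * n%:R :> R.
  apply: (@le_trans _ _ ((2 * k%:R + 1) * b * n%:R)); last by rewrite ler_wpM2r.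
  apply: le_trans hZB; rewrite cW natrD natrM lerD2l ler_wpM2l // ler_nat //.
have [p|v vU|M2 [M2E M2t M2U M2c]] := hnp V E c U (ltnW n0V).
- have h1 : (#|[set v in U | c v == p]| <= #|color_class c p|)%N.
    by apply/subset_leq_card/subsetP => v; rewrite !inE => /andP[].
  have h2 : (#|color_class c p| <= #|[set v in U | c v == p]| + #|W|)%N.
    apply: leq_trans (leq_card_setU _ _); apply/subset_leq_card/subsetP => v.
    move=> vp; have cv : c v == p by move: vp; rewrite inE.
    by rewrite in_setU [v \in [set _ in _ | _]]inE cv andbT in_setC; case: (v \in W).
  move: h1 h2; rewrite -!(ler_nat R) natrD => h1 h2.
  have := hc p; rewrite -/n !ler_norml => /andP[h3 h4]; apply/andP; split; lra.
- have vB : v \notin B.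
    by move: vU; rewrite inE; apply: contra => /(subsetP BM1).
  move: vB; rewrite inE -leNgt -/n => /le_trans; apply.
  by rewrite ler_wpM2r // exprn_ge0.
have d12 : [disjoint cover M1 & cover M2].
  rewrite disjoint_sym disjoints_subset; apply: subset_trans M2U _.
  by rewrite setCS subsetUr.
have [Mt Mc] := matching_union Ek k_gt0 M1E M2E M1t M2t d12.
exists (M1 :|: M2); split=> //.
- by rewrite subUset M1E.
- rewrite /cover bigcup_setU -/(cover M1) -/(cover M2).
  rewrite disjoint_sym disjoints_subset setCU subsetI -!disjoints_subset.
  rewrite disjoint_sym M1Z /= disjoint_sym disjoints_subset.
  by apply: subset_trans M2U _; rewrite setCS subsetUl.
(* M1 covers a multiple of k vertices outside Z, so removing it loses nothing in the rounded
   quotient. *)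
- have -> : (n - #|Z| = #|M1| * k + #|U|)%N.
    have hle : (#|Z| + k * #|M1| <= n)%N by rewrite -cW max_card.
    rewrite (cardsCs U) /U setCK cW mulnC subnDA subnKC //.
    by rewrite leq_subRL // (leq_trans (leq_addr _ _) hle).
  by rewrite divnMDl // Mc M2c.
Qed.

End AvoidingMatchings.

Section EdgesMeeting.
Variables (V : finType) (k : nat) (E : {set {set V}}).
Hypotheses (Ek : uniform k E) (k_gt0 : 0 < k).

(* In the second case a maximal matching of edges meeting L has at most x edges,
   and every edge meeting L contains one of its kx vertices. *)
Lemma matching_or_cover (L : {set V}) (x b : nat) :
  (forall v, v \in L -> deg E v <= b) -> #|L| * #|V| ^ (k - 2) <= b ->
  (exists M : {set {set V}}, [/\ M \subset E, trivIset M, #|M| = x.+1 &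
     #|cover M :\: L| <= (k - 1) * x.+1]) \/
  #|[set e in E | ~~ [disjoint e & L]]| <= k * x * b.
Proof.
move=> hL hb; pose EL := [set e in E | ~~ [disjoint e & L]].
have ELE : EL \subset E by apply/subsetP => e /setIdP[].
pose P (M : {set {set V}}) := [&& M \subset EL, trivIset M & #|M| <= x.+1].
have P0 : P set0.
  rewrite /P sub0set cards0 /= andbT; apply/trivIsetP => e f; by rewrite inE.
case: (@arg_maxnP _ set0 P (fun M => #|M|) P0) => M /and3P[ML Mt Mx] Mmax.
have ME : M \subset E := subset_trans ML ELE.
move: Mx; rewrite leq_eqVlt => /orP[/eqP Mx|Mx]; [left|right].
  exists M; split=> //; rewrite mulnC -Mx.
  apply: (@card_exists_le _ _ M (fun e => e :\: L)).
    by move=> v /setDP[/bigcupP[e eM ve] vL]; exists e; rewrite // inE vL.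
  move=> e eM; have /setIdP[eE eL] := subsetP ML e eM.
  rewrite cardsD (uniformP _ _ Ek e eE) leq_sub2l //.
  by rewrite lt0n cards_eq0 setI_eq0.
(* A cover vertex outside L may have large degree, but only edges joining it to L matter, and there
   are at most [|L| * n ^ (k - 2)] of those. *)
pose F v := if v \in L then [set e in E | v \in e]
  else \bigcup_(u in L) [set e in E | (u \in e) && (v \in e)].
apply: (@leq_trans (#|cover M| * b)); last first.
  by rewrite leq_mul2r (card_cover_matching Ek) // leq_mul2l -ltnS Mx !orbT.
apply: (@card_exists_le _ _ (cover M) F) => [e eEL|v vM]; last first.
  rewrite /F; case: ifP => vL; first exact: hL.
  apply: leq_trans hb; apply: (@card_exists_le _ _ L
      (fun u => [set e in E | (u \in e) && (v \in e)])) => [e /bigcupP[u uL ue]|u uL].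
    by exists u.
  by apply: cod_le => //; apply: contraFneq vL => <-.
have /setIdP[eE /pred0Pn[u /andP[/= ue uL]]] := eEL.
suff /pred0Pn[v /andP[/= ve vM]] : ~~ [disjoint e & cover M].
  exists v => //; rewrite /F; case: ifP => vL; first by rewrite inE eE.
  by apply/bigcupP; exists u; rewrite // inE eE ue.
apply/negP => eM.
have e1 : [set e] \subset E by rewrite sub1set.
have e1L : [set e] \subset EL by rewrite sub1set.
have et : trivIset [set e] by apply/trivIsetP => a b' /set1P-> /set1P->; rewrite eqxx.
have ed : [disjoint cover [set e] & cover M] by rewrite /cover big_set1.
have [t' c'] := matching_union Ek k_gt0 e1 ME et Mt ed.
have /Mmax : P ([set e] :|: M).
  by rewrite /P subUset e1L ML t' c' cards1 add1n Mx.
by rewrite /= c' cards1 add1n ltnn.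
Qed.

End EdgesMeeting.

(** * The main bound *)

(** Each of the x + 1 edges uses at most k - 1 vertices outside L, so at least k (s - x) vertices
    remain outside Z, enough for s - x further edges. *)
Lemma matching_count n k s x (L Z : nat) : 0 < k -> k * s + k <= n ->
  L = n - (k * s + k) + x.+1 -> Z <= L + (k - 1) * x.+1 ->
  s.+1 <= x.+1 + (n - Z) %/ k.
Proof.
move=> k0 ksn eL hZ; rewrite addSn ltnS -leq_subLR leq_divRL // mulnC mulnBr.
move: hZ; rewrite mulnBl mul1n mulnS; have : x <= k * x by rewrite leq_pmull.
move: (k * s) (k * x) ksn eL => a b; lia.
Qed.

Section UpperBound.
Local Open Scope ring_scope.
Variable R : realType.
Variables k l : nat.
Hypotheses (k3 : (2 < k)%N) (kl : (k < l)%N).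

Let k_gt0 : (0 < k)%N. Proof. by apply: leq_trans k3. Qed.
Let l_gt0 : (0 < l)%N. Proof. by apply: leq_trans kl. Qed.

Lemma deg_cross_ge (V : finType) (c : V -> 'I_l) v : large_classes R c ->
  (((k - 1)`! * (2 * l) ^ (k - 1))%N%:R)^-1 * #|V|%:R ^+ (k - 1) <= (deg (cross c k) v)%:R :> R.
Proof.
move=> hc.
have vc : [set v] \in cross c 1.
  by apply/crossP; rewrite cards1; split=> // a b /set1P-> /set1P->.
have := cross_sup_ge k3 (ltnW kl) vc k_gt0 hc.
rewrite expr_div_n => h; rewrite natrM natrX invfM -mulrA mulrC ler_pdivrMr ?ltr0n ?fact_gt0 //.
rewrite mulrC; apply: (le_trans h); rewrite mulrC ler_wpM2r // ler_nat.
by apply/subset_leq_card/subsetP => e; rewrite !inE sub1set.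
Qed.

Lemma matching_free_upper_bound : exists (beta : R) (s0 : nat), 0 < beta /\
  forall (V : finType) (s : nat), (s0 <= s)%N ->
  #|V|%:R - (k * s)%:R <= beta * #|V|%:R -> (k * s + k <= #|V|)%N ->
  forall E : {set {set V}}, uniform k E ->
  ~~ contains (Hypergraph E) (expanded_clique k l.+1) ->
  ~~ contains (Hypergraph E) (matching k s.+1) ->
  (#|E| <= exk k (k * s + k - 1) [:: expanded_clique k l.+1])%N.
Proof.
have kl' := ltnW kl.
have K1 : 1 <= k%:R :> R by rewrite ler1n.
have K0 : 0 < k%:R :> R by rewrite ltr0n.
have L0 : 0 < l%:R :> R by rewrite ltr0n.
have [eta [tM [nM [eta0 tM0 hM]]]] := matching_avoiding R k3 kl.
have [c0 [m0 [c00 hstep]]] := exk_steps R k3 kl'.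
have [rho [rho0 hrho]] : exists rho : R, 0 < rho /\
    forall (V : finType) (c : V -> 'I_l) v, large_classes R c ->
    rho * #|V|%:R ^+ (k - 1) <= (deg (cross c k) v)%:R.
  eexists; split; last exact: deg_cross_ge.
  by rewrite invr_gt0 ltr0n muln_gt0 fact_gt0 expn_gt0 muln_gt0 l_gt0.
(* Every vertex lies in at least [rho * n ^ (k - 1)] crossing sets. With t and g at most rho/2, a
   vertex of small degree therefore misses enough of them to be bad. *)
have [t [t0 ttM trho]] : exists t : R, [/\ 0 < t, t <= tM & t <= rho / 2].
  have rho2 : 0 < rho / 2 by rewrite divr_gt0.
  by exists (Num.min tM (rho / 2)); rewrite lt_min !ge_min !lexx tM0 rho2 orbT.
have P0 : 0 < 2 ^+ (k - 1) :> R by rewrite exprn_gt0.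
(* At least n/2 vertices remain after deleting L, hence the power of 2: the edges lost per unit of x
   then cost no more than one increment of the extremal function. *)
have [g [g0 grho gc0]] : exists g : R, [/\ 0 < g, g <= rho / 2 & k%:R * g <= c0 / 2 ^+ (k - 1)].
  have rho2 : 0 < rho / 2 by rewrite divr_gt0.
  have cP : 0 < c0 / 2 ^+ (k - 1) / k%:R by rewrite !divr_gt0.
  exists (Num.min (rho / 2) (c0 / 2 ^+ (k - 1) / k%:R)).
  by rewrite [k%:R * _]mulrC -ler_pdivlMr // lt_min !ge_min !lexx rho2 cP orbT.
have K21 : 0 < 2 * k%:R + 1 :> R by lra.
have [b [b0 bg beta bh]] : exists b : R,
    [/\ 0 < b, (2 * k%:R + 1) * b < g, (2 * k%:R + 1) * b <= eta & b <= 1 / 2].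
  have g2 : 0 < g / 2 by rewrite divr_gt0.
  have g2' : 0 < g / 2 / (2 * k%:R + 1) by rewrite divr_gt0.
  have e2' : 0 < eta / (2 * k%:R + 1) by rewrite divr_gt0.
  have h2 : 0 < 1 / 2 :> R by rewrite divr_gt0.
  exists (Num.min (g / 2 / (2 * k%:R + 1)) (Num.min (eta / (2 * k%:R + 1)) (1 / 2))).
  split; first by rewrite !lt_min g2' e2' h2.
  - apply: (@le_lt_trans _ _ (g / 2)); last by lra.
    by rewrite [_ * Num.min _ _]mulrC -ler_pdivlMr // ge_min lexx.
  - by rewrite [_ * Num.min _ _]mulrC -ler_pdivlMr // !ge_min lexx orbT.
  - by rewrite !ge_min lexx !orbT.
have bg' : b <= g by apply: ltW; apply: le_lt_trans bg; rewrite ler_peMl ?(ltW b0) //; lra.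
have [e [e0 eeta etb el]] : exists e : R,
    [/\ 0 < e, e <= eta, e * k%:R <= t * b & e <= 1 / (2 * l%:R)].
  have tb : 0 < t * b / k%:R by rewrite divr_gt0 ?mulr_gt0.
  have l2 : 0 < 1 / (2 * l%:R) :> R by rewrite divr_gt0 ?mulr_gt0.
  exists (Num.min eta (Num.min (t * b / k%:R) (1 / (2 * l%:R)))).
  by rewrite -ler_pdivlMr // !lt_min !ge_min !lexx eta0 tb l2 !orbT.
have [delta [nS [delta0 hS]]] := stability k3 kl' e0.
have d20 : 0 < delta / 2 by rewrite divr_gt0.
have [nD hD] := exk_ge_density k3 kl' d20.
have dens0 := density_gt0 R kl' k_gt0.
(* By Bernoulli's inequality, passing from n to N lowers the main term by at most
   [density * k * (n - N) * n ^ (k - 1)], which this [beta] bounds by [delta / 2 * n ^ k]; so E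
   stays in the range of stability. The bound [2 * m0] makes the increments valid from n/2 on. *)
exists (delta / 2 / (density R k l * k%:R)), (maxn (maxn nM.+1 nS) (maxn nD (2 * m0))).
split; first by apply: divr_gt0 => //; apply: mulr_gt0.
move=> V s; rewrite !geq_max => /andP[/andP[sM sS] /andP[sD sm0]].
set n := #|V| => hbeta ksn E Ek Ef Em.
set f := fun m => exk k m [:: expanded_clique k l.+1].
set N := (k * s + k - 1)%N.
have sN : (s <= N)%N by rewrite /N -addnBA // (leq_trans _ (leq_addr _ _)) // leq_pmull.
have Nn : (N <= n)%N by rewrite (leq_trans _ ksn) // leq_subr.
have [//|fE] := leqP #|E| (f N); exfalso.
have sn := leq_trans sN Nn.
have n_gt0 : 0 < n%:R :> R by rewrite ltr0n (leq_ltn_trans _ (leq_trans sM sn)).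
have y0 : 0 < n%:R ^+ (k - 1) :> R by rewrite exprn_gt0.
have nk : n%:R ^+ k = n%:R * n%:R ^+ (k - 1) :> R.
  by rewrite -[in LHS](subn0 k) expr_subS.
have nk1 : n%:R ^+ (k - 1) = n%:R * n%:R ^+ (k - 2) :> R.
  by rewrite expr_subS // ltnW.
have hE : (density R k l - delta) * n%:R ^+ k <= #|E|%:R.
  apply: (@le_trans _ _ (f N)%:R); last by rewrite ler_nat ltnW.
  apply: le_trans (hD N (leq_trans sD sN)).
  have nN0 : 0 <= n%:R - N%:R :> R by rewrite subr_ge0 ler_nat.
  have nNn : n%:R - N%:R <= n%:R :> R by rewrite lerBlDr lerDl.
  have := expr_sub_ge k nN0 nNn; rewrite subKr => hNk.
  have hNk' : N%:R ^+ k <= n%:R ^+ k :> R by rewrite ler_expr // ler_nat.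
  have hy : (n%:R - N%:R) * (density R k l * k%:R) <= delta / 2 * n%:R.
    have dk : 0 < density R k l * k%:R by apply: mulr_gt0.
    rewrite -(ler_pdivlMr _ _ dk) [X in _ <= X]mulrAC; apply: le_trans hbeta.
    by rewrite lerD2l lerN2 ler_nat /N -addnBA // leq_addr.
  have := ler_wpM2r (ltW y0) hy; have := ler_wpM2l (ltW dens0) hNk.
  have := ler_wpM2l (ltW d20) hNk'; rewrite nk.
  move: (n%:R - N%:R) (N%:R ^+ k) (n%:R ^+ (k - 1)) => yy u w; lra.
have [c [cD cS]] := hS V E Ek Ef (leq_trans sS sn) hE; rewrite -/n in cD cS.
have hc : large_classes R c.
  move=> i; rewrite -/n natrM; have := cS i; rewrite ler_norml => /andP[+ _].
  have := ler_wpM2r (ltW n_gt0) el.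
  have -> : n%:R / l%:R = 2 * (1 / (2 * l%:R) * n%:R) :> R by field; rewrite gt_eqF.
  have -> : n%:R / (2 * l%:R) = 1 / (2 * l%:R) * n%:R :> R by field; rewrite gt_eqF.
  lra.
have crossD : uniform k (cross c k :\: E).
  exact: uniformS (subsetDl _ _) (cross_uniform _ _).
pose B := bad_vertices k E c t.
have hB : #|B|%:R <= b * n%:R :> R.
  rewrite -(ler_pM2r (mulr_gt0 t0 y0)); apply: le_trans (card_deg_gt _ crossD) _.
  apply: (@le_trans _ _ (e * n%:R ^+ k * k%:R)); first by rewrite ler_wpM2r.
  by have := ler_wpM2r (ltW (mulr_gt0 n_gt0 y0)) etb; rewrite nk; lra.
pose L := [set v | (deg E v)%:R < g * n%:R ^+ (k - 1)].
have LB : L \subset B.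
  apply/subsetP => v; apply: contraTT; rewrite !inE -!leNgt -/n => hv.
  have : (deg (cross c k) v <= deg (cross c k :\: E) v + deg E v)%N.
    apply: leq_trans (leq_card_setU _ _); apply/subset_leq_card/subsetP => a.
    by rewrite in_setU !inE => /andP[-> ->]; case: (a \in E).
  rewrite -(ler_nat R) natrD => h; have := hrho V c v hc; rewrite -/n.
  have := ler_wpM2r (ltW y0) trho; have := ler_wpM2r (ltW y0) grho; lra.
have hL : #|L|%:R <= b * n%:R :> R.
  by apply: le_trans hB; rewrite ler_nat subset_leq_card.
have hMZ (Z : {set V}) : L \subset Z -> #|Z|%:R <= (k%:R + 1) * b * n%:R :> R ->
    exists M : {set {set V}}, [/\ M \subset E, trivIset M, [disjoint cover M & Z] &
    #|M| = ((n - #|Z|) %/ k)%N].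
  move=> LZ hZ; apply: (hM V E c Z t g b Ek) => //.
  - exact: leq_trans sn.
  - by move=> p; apply: le_trans (cS p) _; rewrite ler_wpM2r.
  - by move=> v /(contra (subsetP LZ v)); rewrite inE -leNgt.
have noM (M : {set {set V}}) : M \subset E -> trivIset M -> (#|M| <= s)%N.
  by move=> ME Mt; rewrite leqNgt; apply: contra Em; apply: matching_contains.
have [Lr|Lr] := leqP #|L| (n - (k * s + k)).
  have [||M [ME Mt _ Mc]] := hMZ L => //.
    by apply: le_trans hL _; rewrite ler_wpM2r // ler_peMl ?(ltW b0) //; lra.
  have := noM M ME Mt; rewrite Mc leqNgt leq_divRL // => /negP; apply.
  rewrite leq_subRL; last by apply: leq_trans Lr (leq_subr _ _).
  by rewrite mulSn [(s * k)%N]mulnC [(k + _)%N]addnC addnC -leq_subRL.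
pose x := (#|L| - (n - (k * s + k)) - 1)%N.
have Lx : #|L| = (n - (k * s + k) + x.+1)%N.
  by rewrite /x subn1 prednK ?subn_gt0 // subnKC // ltnW.
have [v vL||[M2 [M2E M2t M2c M2L]]|hEL] :=
    @matching_or_cover V k E Ek k_gt0 L x (Num.trunc (g * n%:R ^+ (k - 1))).
- by apply: leq_trunc; apply: ltW; move: vL; rewrite inE.
- apply: leq_trunc; rewrite natrM natrX nk1 mulrA ler_wpM2r ?exprn_ge0 //.
  by apply: le_trans hL _; rewrite ler_wpM2r.
- pose Z := L :|: cover M2.
  have hZ : (#|Z| <= #|L| + (k - 1) * x.+1)%N.
    rewrite /Z -(setID (L :|: _) L) setUK setDUl setDv set0U.
    by apply: leq_trans (leq_card_setU _ _) _; rewrite leq_add2l.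
  have [||M3 [M3E M3t M3Z M3c]] := hMZ Z.
  - exact: subsetUl.
  - apply: (@le_trans _ _ (k * #|L|)%N%:R).
      rewrite ler_nat (leq_trans hZ) // -[in X in (_ <= X)%N](prednK k_gt0) mulSn leq_add2l.
      by rewrite subn1 leq_mul2l Lx leq_addl orbT.
    rewrite natrM; have := ler_wpM2l (ler0n R k) hL.
    have : 0 <= b * n%:R by rewrite mulr_ge0 ?(ltW b0).
    lra.
  have d23 : [disjoint cover M2 & cover M3].
    by rewrite disjoint_sym; apply: disjointWr M3Z; apply: subsetUr.
  have [Mt Mc] := matching_union Ek k_gt0 M2E M3E M2t M3t d23.
  have := noM (M2 :|: M3) _ Mt; rewrite subUset M2E M3E => /(_ isT).
  by rewrite Mc M2c M3c leqNgt (matching_count k_gt0 ksn Lx hZ).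
have hsplit : (#|E| <= #|[set a in E | ~~ [disjoint a & L]]| + #|[set a in E | a \subset ~: L]|)%N.
  apply: leq_trans (leq_card_setU _ _); apply/subset_leq_card/subsetP => a aE.
  by rewrite !inE aE -disjoints_subset orNb.
pose m := #|~: L|.
have mE : (m = n - #|L|)%N by rewrite /m cardsCs setCK.
have mx : (m + x = N)%N.
  have : (#|L| <= n)%N by apply: max_card.
  rewrite mE Lx /N; move: ksn; move: (k * s)%N => a; clear -k_gt0; clearbody n x.
  by move: k_gt0; lia.
have mR : n%:R / 2 <= m%:R :> R.
  rewrite mE natrB ?max_card //; have := ler_wpM2r (ltW n_gt0) bh; lra.
have mm0 : (m0 <= m)%N.
  rewrite -(ler_nat R); apply: le_trans mR; rewrite ler_pdivlMr // mulrC -natrM ler_nat.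
  exact: leq_trans sn.
have := hstep m x mm0; rewrite mx.
have hcm : k%:R * g * n%:R ^+ (k - 1) <= c0 * m%:R ^+ (k - 1).
  apply: (@le_trans _ _ (c0 * (n%:R / 2) ^+ (k - 1))); last first.
    rewrite ler_wpM2l ?(ltW c00) // ler_expr ?divr_ge0 //.
  rewrite expr_div_n mulrA [X in _ <= X]mulrAC.
  by apply: ler_wpM2r => //; apply: ltW.
have := exk_induced (~: L) Ek Ef; rewrite -/m -/(f m) -/(f N).
move: hsplit hEL fE; rewrite -!(ler_nat R) -natr1 natrD.
have : (k * x * Num.trunc (g * n%:R ^+ (k - 1)))%N%:R <= x%:R * (k%:R * g * n%:R ^+ (k - 1)).
  rewrite !natrM [k%:R * x%:R]mulrC -!mulrA ler_wpM2l // ler_wpM2l //.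
  by rewrite trunc_ler // mulr_ge0 ?exprn_ge0 // ltW.
have := ler_wpM2l (ler0n R x) hcm.
lra.
Qed.

End UpperBound.

Local Open Scope ring_scope.

Theorem theorem1p5 (R : realType) (l k : nat) (hk : (3 <= k)%N) (hl : (k < l)%N) :
  exists (beta : R) (s0 : nat), 0 < beta /\
    forall n s : nat,
      Num.max (s0%:R) (n%:R / k%:R - beta * n%:R) < s%:R :> R ->
      s%:R <= (n%:R - k%:R) / k%:R :> R ->
      exk k n [:: expanded_clique k l.+1; matching k s.+1]
      = exk k (k * s + k - 1) [:: expanded_clique k l.+1].
Proof.
have k_gt0 : (0 < k)%N by apply: leq_trans hk.
have l_gt0 : (0 < l)%N by apply: leq_trans hl.
have K0 : 0 < k%:R :> R by rewrite ltr0n.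
have [beta [s0 [beta0 upper]]] := matching_free_upper_bound R hk hl.
(* The upper bound controls n - ks, which is k times the deficit n/k - s. *)
exists (beta / k%:R), s0; split; first by rewrite divr_gt0.
move=> n s; rewrite gt_max ltr_nat => /andP[/ltnW s0s nks] sn.
have ksn : (k * s + k <= n)%N.
  move: sn; rewrite ler_pdivlMr // lerBrDr -natrM -natrD ler_nat.
  by rewrite mulnC.
apply/eqP; rewrite eqn_leq; apply/andP; split; last first.
  by apply: exk_matching_ge => //; apply: leq_trans ksn; apply: leq_subr.
apply/bigmax_leqP => E /andP[Ek /and3P[Ef Em _]].
apply: upper => //; rewrite card_ord //.
have := ler_wpM2l (ltW K0) (ltW nks).
have -> : k%:R * (n%:R / k%:R - beta / k%:R * n%:R) = n%:R - beta * n%:R :> R.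
  by field; rewrite gt_eqF.
rewrite -natrM; lra.
Qed.
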